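(* Let $\varphi$ be a Musielak–Orlicz function. Then for every $r\in(0,1]$, $H^s_\varphi(\Omega)=H^{\varphi,\infty,s}_{\mathrm{at},r}(\Omega)$ with equivalent quasi-norms.
   Context: Let $(\Omega,\mathcal F,\mathbb P)$ be a probability space, $(\mathcal F_n)_{n\in\mathbb Z_+}$ a nondecreasing sequence of sub-$\sigma$-algebras, $\mathbb E_n$ the conditional expectations. A Musielak–Orlicz function is $\varphi:\Omega\times[0,\infty)\to[0,\infty)$ with $\varphi(x,\cdot)$ nondecreasing, $\varphi(x,0)=0$, $\lim_{t\to\infty}\varphi(x,t)=\infty$ for each $x$, $\varphi(\cdot,t)$ measurable for each $t$; $\|f\|_{L^\varphi(\Omega)}:=\inf\{\lambda>0:\int_\Omega\varphi(x,|f|/\lambda)\,d\mathbb P\le1\}$. $\mathcal M$ is the set of martingales $f=(f_n)_{n\in\mathbb Z_+}$ w.r.t. $(\mathcal F_n)$ with $f_0=0$; $d_nf:=f_n-f_{n-1}$; $s(f):=(\sum_{i\ge1}\mathbb E_{i-1}|d_if|^2)^{1/2}$; $H^s_\varphi(\Omega):=\{f\in\mathcal M:\|f\|_{H^s_\varphi}:=\|s(f)\|_{L^\varphi(\Omega)}<\infty\}$. For a stopping time $\nu$, $B_\nu:=\{\nu<\infty\}$. A measurable function $a$ is a $(\varphi,\infty)_s$-atom if there is a stopping time $\nu$ with (i) $a_n:=\mathbb E_na=0$ whenever $\nu\ge n$, and (ii) $\|s(a)\|_{L^\infty(B_\nu)}\le\|\mathbf 1_{B_\nu}\|_{L^\varphi(\Omega)}^{-1}$.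 For $r>0$, $H^{\varphi,\infty,s}_{\mathrm{at},r}(\Omega)$ is the set of $f\in\mathcal M$ for which there exist nonnegative reals $(\mu^k)_{k\in\mathbb Z}$ and $(\varphi,\infty)_s$-atoms $a^k$ with associated stopping times $\nu^k$ such that $f_n=\sum_{k\in\mathbb Z}\mu^ka^k_n$ for all $n\in\mathbb Z_+$ and $\big\|\{\sum_{k}[\mu^k\mathbf 1_{B_{\nu^k}}/\|\mathbf 1_{B_{\nu^k}}\|_{L^\varphi(\Omega)}]^r\}^{1/r}\big\|_{L^\varphi(\Omega)}<\infty$; its quasi-norm is the infimum of this last quantity over all such decompositions. *)

(* Defs.v *)
From HB Require Import structures.
From mathcomp Require Import all_boot all_order all_algebra.
From mathcomp Require Import all_classical all_reals all_analysis measurable_realfun.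
Set Implicit Arguments. Unset Strict Implicit. Unset Printing Implicit Defensive.
Import Order.TTheory GRing.Theory Num.Theory.
Import numFieldNormedType.Exports.
Local Open Scope classical_set_scope.
Local Open Scope ring_scope.

Section MartingaleHardy.
Context {d : measure_display} {T : measurableType d} {R : realType}.
Variable P : probability T R.
Variable F : nat -> set (set T).

Definition is_filtration : Prop :=
  (forall n, sigma_algebra setT (F n)) /\
  (forall n A, F n A -> measurable A) /\
  (forall n m, (n <= m)%N -> F n `<=` F m).

(* Musielak-Orlicz function (phi x t is only relevant for t >= 0) *)
Definition MO_function (phi : T -> R -> R) : Prop :=
  (forall x t, 0 <= t -> 0 <= phi x t) /\
  (forall x s t, 0 <= s -> s <= t -> phi x s <= phi x t) /\
  (forall x, phi x 0 = 0) /\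
  (forall x, phi x t @[t --> +oo] --> +oo) /\
  (forall t, 0 <= t -> measurable_fun setT (fun x => phi x t)).

Definition G_meas (G : set (set T)) (g : T -> R) : Prop :=
  forall B : set R, measurable B -> G (g @^-1` B).
Definition G_meas_e (G : set (set T)) (g : T -> \bar R) : Prop :=
  forall B : set (\bar R), measurable (B : set (\bar R)) -> G (g @^-1` B).

(* g is a version of the conditional expectation E[f | G] (f integrable) *)
Definition is_cexp (G : set (set T)) (f g : T -> R) : Prop :=
  G_meas G g /\ P.-integrable setT (EFin \o g) /\
  forall A, G A -> (\int[P]_(x in A) (g x)%:E = \int[P]_(x in A) (f x)%:E)%E.

Definition is_cexp_nn (G : set (set T)) (f g : T -> \bar R) : Prop :=
  G_meas_e G g /\ (forall x, (0 <= g x)%E) /\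
  forall A, G A -> (\int[P]_(x in A) g x = \int[P]_(x in A) f x)%E.

Definition cexp (G : set (set T)) (f : T -> R) : T -> R :=
  match pselect (exists g, is_cexp G f g) with
  | left h => proj1_sig (boolp.constructive_indefinite_description h)
  | right _ => fun _ => 0
  end.

Definition cexp_nn (G : set (set T)) (f : T -> \bar R) : T -> \bar R :=
  match pselect (exists g, is_cexp_nn G f g) with
  | left h => proj1_sig (boolp.constructive_indefinite_description h)
  | right _ => fun _ => 0%E
  end.

Definition martingale (f : nat -> T -> R) : Prop :=
  (forall x, f 0%N x = 0) /\
  (forall n, G_meas (F n) (f n)) /\
  (forall n, P.-integrable setT (EFin \o f n)) /\
  (forall n, is_cexp (F n) (f n.+1) (f n)).

Definition sqfun (f : nat -> T -> R) : T -> \bar R := fun x =>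
  sqrte (\sum_(i <oo)
     cexp_nn (F i) (fun y => ((f i.+1 y - f i y) ^+ 2)%:E) x)%E.

Definition phi_modular (phi : T -> R -> R) (lam : R) (g : T -> \bar R) : \bar R :=
  (\int[P]_x (match g x with
              | r%:E => (phi x (r / lam))%:E
              | _ => +oo end))%E.

Definition LMO_norm (phi : T -> R -> R) (g : T -> \bar R) : \bar R :=
  ereal_inf [set lam%:E | lam in [set lam : R | 0 < lam /\
                                   (phi_modular phi lam g <= 1)%E]].

Definition Hs_norm (phi : T -> R -> R) (f : nat -> T -> R) : \bar R :=
  LMO_norm phi (sqfun f).

(* stopping times with values in Z_+ \cup {oo} (None = oo) *)
Definition stopping_time (nu : T -> option nat) : Prop :=
  forall n, F n [set x | nu x = Some n].

Definition Bset (nu : T -> option nat) : set T := [set x | nu x <> None].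

Definition nu_ge (nu : T -> option nat) (n : nat) (x : T) : Prop :=
  match nu x with None => True | Some m => (n <= m)%N end.

Definition ind_norm (phi : T -> R -> R) (nu : T -> option nat) : \bar R :=
  LMO_norm phi (fun x => (\1_(Bset nu) x)%:E).

Definition is_atom (phi : T -> R -> R) (a : T -> R) (nu : T -> option nat) : Prop :=
  stopping_time nu /\
  P.-integrable setT (EFin \o a) /\
  (forall n, {ae P, forall x, nu_ge nu n x -> cexp (F n) a x = 0}) /\
  {ae P, forall x, Bset nu x ->
     (sqfun (fun n => cexp (F n) a) x <= (ind_norm phi nu)^-1)%E}.

(* f_n = sum_{k in Z} mu^k a^k_n, a.e., as limit of symmetric partial sums *)
Definition atomic_decomp (phi : T -> R -> R) (f : nat -> T -> R)
    (mu : int -> R) (a : int -> T -> R) (nu : int -> T -> option nat) : Prop :=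
  (forall k, 0 <= mu k) /\
  (forall k, is_atom phi (a k) (nu k)) /\
  (forall n, {ae P, forall x,
     (fun N : nat => \sum_(i < N.*2.+1)
         mu (i%:Z - N%:Z) * cexp (F n) (a (i%:Z - N%:Z)) x) @ \oo
       --> f n x}).

Definition at_quantity (phi : T -> R -> R) (r : R)
    (mu : int -> R) (nu : int -> T -> option nat) : \bar R :=
  LMO_norm phi (fun x =>
    poweR (\esum_(k in [set: int])
             poweR ((mu k)%:E * (\1_(Bset (nu k)) x)%:E
                      * (ind_norm phi (nu k))^-1)%E r) r^-1).

(* the quasi-norm of H^{phi,oo,s}_{at,r}; +oo if there is no decomposition *)
Definition Hat_norm (phi : T -> R -> R) (r : R) (f : nat -> T -> R) : \bar R :=
  ereal_inf [set q | exists mu a nu,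
               atomic_decomp phi f mu a nu /\ q = at_quantity phi r mu nu].

End MartingaleHardy.

(* Main.v *)
(* For f in H^s_phi, let s_n^2 = sum_(i < n) E_i |d_(i+1) f|^2, which is
   F_(n-1)-measurable, and stop f at the times nu_k when s_(n+1) first exceeds
   2^k.  The martingale f^(nu_(k+1)) - f^(nu_k) only collects the increments
   d_(i+1) f on { 2^k < s_(i+1) <= 2^(k+1) }, so its conditional square function
   is at most 2^(k+1) and it is closed by its L^2 limit; dividing it by
   mu_k = 2^(k+1) || 1_(B_k) ||, B_k = { nu_k < oo } = { s(f) > 2^k }, gives an
   atom.  The atomic quantity is then a geometric sum over { k | 2^k < s(f) },
   bounded pointwise by a multiple of s(f).
   Conversely, if f = sum_k mu_k a^k, Cauchy-Schwarz with the F_i-measurable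
   weights mu_k beta_k 1_{nu_k <= i}, beta_k = || 1_(B_k) ||^-1, followed by
   summation over i gives s(f) <= sum_k mu_k beta_k 1_(B_k) almost everywhere,
   and the l^1 norm is at most the l^r quasi-norm since r <= 1. *)

Require Import Defs.
From HB Require Import structures.
From mathcomp Require Import all_boot all_order all_algebra.
From mathcomp Require Import all_classical all_reals all_analysis measurable_realfun.
From mathcomp Require Import ring lra zify.
Set Implicit Arguments. Unset Strict Implicit. Unset Printing Implicit Defensive.
Import Order.TTheory GRing.Theory Num.Theory.
Import numFieldNormedType.Exports.
Local Open Scope classical_set_scope.
Local Open Scope ring_scope.

(** * Conditional expectations *)

(** Conditional expectations are arbitrary choices of versions, so each identity about them is
    checked by integrating over sets of the sub-sigma-algebra, and exceptional null sets are
    gathered over countable families. Squares of increments of a martingale may have infinite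
    integral; conditional expectations of nonnegative functions therefore live in [\bar R] and are
    built and compared there. In the estimate of s(f), the square of an increment is bounded
    pointwise by a double series whose terms are an F_i-measurable factor times a squared increment
    of an atom, and conditioning then acts on the second factor alone. The closing variable of a
    piece is an almost everywhere limit along a fast subsequence, whose differences are summable in
    L^1. Degenerate supports appear in both directions: when || 1_(B_k) || = 0 its inverse is [+oo],
    and the argument survives because B_k is then a null set. *)

Lemma max0M (R : realDomainType) (a b : R) :
  Num.max (a * b) 0 =
  Num.max a 0 * Num.max b 0 + Num.max (- a) 0 * Num.max (- b) 0.
Proof.
have [a0|/ltW a0] := leP 0 a; have [b0|/ltW b0] := leP 0 b.
- rewrite (max_r (_ : - a <= 0)) ?oppr_le0// mul0r addr0.
  by rewrite max_l// mulr_ge0.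
- rewrite mulr0 (max_r (_ : - a <= 0)) ?oppr_le0// mul0r addr0.
  by rewrite max_r// mulr_ge0_le0.
- rewrite mul0r (max_r (_ : - b <= 0)) ?oppr_le0// mulr0 addr0.
  by rewrite max_r// mulr_le0_ge0.
- rewrite mul0r add0r !(max_l (_ : 0 <= - _)) ?oppr_ge0//.
  by rewrite mulrNN max_l// mulr_le0.
Qed.

Section SubSigmaAlgebra.
Context {d : measure_display} {T : measurableType d} {R : realType}.
Variables (P : probability T R) (G : set (set T)).
Hypotheses (sG : sigma_algebra setT G) (GM : forall A, G A -> measurable A).

Local Notation T' := (g_sigma_algebraType G).

(** As [G] is already a sigma-algebra, generating from it adds nothing. Working on [T'] makes the
    closure rules for measurable sets and functions available for [G]. *)
Lemma sub_measurableP (A : set T) : measurable (A : set T') <-> G A.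
Proof. by rewrite -[X in _ <-> X _](sigma_algebra_id sG). Qed.

Lemma G_setT : G setT.
Proof. by apply/sub_measurableP; exact: measurableT. Qed.

Lemma G_setI (A B : set T) : G A -> G B -> G (A `&` B).
Proof.
by move=> /sub_measurableP GA /sub_measurableP GB; apply/sub_measurableP;
  exact: measurableI.
Qed.

Lemma G_setC (A : set T) : G A -> G (~` A).
Proof.
by move=> /sub_measurableP GA; apply/sub_measurableP; exact: measurableC.
Qed.

Lemma G_meas_eP (g : T -> \bar R) :
  G_meas_e G g <-> measurable_fun setT (g : T' -> \bar R).
Proof.
split=> [gG _ B mB|mg B mB].
  by rewrite setTI; apply/sub_measurableP; exact: gG.
by apply/sub_measurableP; rewrite -[X in measurable X]setTI; exact: mg.
Qed.

Lemma G_measP (g : T -> R) :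
  G_meas G g <-> measurable_fun setT (g : T' -> R).
Proof.
split=> [gG _ B mB|mg B mB].
  by rewrite setTI; apply/sub_measurableP; exact: gG.
by apply/sub_measurableP; rewrite -[X in measurable X]setTI; exact: mg.
Qed.

Lemma G_meas_e_measurable (g : T -> \bar R) :
  G_meas_e G g -> measurable_fun setT g.
Proof. by move=> gG _ B mB; rewrite setTI; exact/GM/gG. Qed.

Lemma G_meas_measurable (g : T -> R) : G_meas G g -> measurable_fun setT g.
Proof. by move=> gG _ B mB; rewrite setTI; exact/GM/gG. Qed.

Lemma measurable_fun_to_sub : measurable_fun setT (id : T -> T').
Proof. by move=> _ A /sub_measurableP GA; rewrite setTI; exact: GM. Qed.

(** Radon-Nikodym on [T']: the indefinite integral of [X], restricted to [G], is a finite measure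
    dominated by the restriction of [P], and its density is the desired version. *)
Lemma is_cexp_nn_finite_integral (X : T -> \bar R) :
  measurable_fun setT X -> (forall x, (0 <= X x)%E) ->
  (\int[P]_x X x < +oo)%E -> exists g, is_cexp_nn P G X g.
Proof.
move=> mX X0 intX.
pose nu (A : set T') := (\int[P]_(x in (A : set T)) X x)%E.
have mA (A : set T') : measurable A -> measurable (A : set T).
  by move=> /sub_measurableP; exact: GM.
have nu0 : nu set0 = 0%E by rewrite /nu integral_set0.
have nu_ge0 A : (0 <= nu A)%E by apply: integral_ge0 => x _; exact: X0.
have nu_sa : semi_sigma_additive nu.
  move=> S mS tS mUS; apply: (semi_sigma_additive_nng_induced mX X0) => //.
    by move=> i; apply: mA.
  exact: mA.
have nu_fin : fin_num_fun nu.
  move=> A mA'; rewrite ge0_fin_numE//; apply: le_lt_trans intX.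
  by apply: ge0_subset_integral => //; exact: mA.
have nu_fin' : fin_num_fun nu by [].
pose m0 : {measure set T' -> \bar R} :=
  HB.pack nu (isMeasure.Build _ _ _ nu nu0 nu_ge0 nu_sa).
pose m : {finite_measure set T' -> \bar R} :=
  HB.pack nu m0 (@Measure_isFinite.Build _ _ _ m0 nu_fin).
pose rho (A : set T') := P (A : set T).
have rho_sa : semi_sigma_additive rho.
  move=> S mS tS mUS; apply: measure_semi_sigma_additive => //.
    by move=> i; apply: mA.
  exact: mA.
pose mu0 : {measure set T' -> \bar R} :=
  HB.pack rho (isMeasure.Build _ _ _ rho (measure0 P)
     (fun A => measure_ge0 P A) rho_sa).
have mu_fin : fin_num_fun mu0.
  by move=> A mA'; exact: fin_num_measure (mA _ mA').
pose mu : {finite_measure set T' -> \bar R} :=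
  HB.pack rho mu0 (@Measure_isFinite.Build _ _ _ mu0 mu_fin).
have m_mu : m `<< mu.
  apply/null_content_dominatesP => A mA' muA; apply: null_set_integral => //.
  - exact: mA.
  - exact: measurable_funTS.
have [g [g0 ig gE]] := radon_nikodym_finite m_mu.
have mg : measurable_fun setT (g : T' -> \bar R) := measurable_int _ ig.
exists g; split; first exact/G_meas_eP.
split=> // A GA.
have mA' : measurable (A : set T') by apply/sub_measurableP.
rewrite -[RHS]/(m A) gE//.
(* [mu] is the image of [P] under the identity from [T] to [T'], so integrating the density on [T']
   amounts to integrating it against [P]. *)
have := @ge0_integral_pushforward _ _ T T' R id measurable_fun_to_sub P A g mA'.
by move=> ->//; exact: measurable_funTS.
Qed.

Lemma is_cexp_nn_series (X g : nat -> T -> \bar R) :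
  (forall n, measurable_fun setT (X n)) -> (forall n x, (0 <= X n x)%E) ->
  (forall n, is_cexp_nn P G (X n) (g n)) ->
  is_cexp_nn P G (fun x => \sum_(n <oo) X n x)%E
    (fun x => \sum_(n <oo) g n x)%E.
Proof.
move=> mX X0 cg.
have gG n : G_meas_e G (g n) by case: (cg n).
have g0 n x : (0 <= g n x)%E by case: (cg n) => _ [].
split; last split => [x|A GA].
- apply/G_meas_eP; apply: (@ge0_emeasurable_sum _ T' R) => [n x _ _|n _].
    exact: g0.
  exact/G_meas_eP.
- by apply: nneseries_ge0 => n _ _; exact: g0.
have mA : measurable A by exact: GM.
rewrite !integral_nneseries//.
- apply: eq_eseriesr => n _.
  by case: (cg n) => _ [_ ->].
- by move=> n; apply: measurable_funTS; exact: mX.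
- by move=> n; apply: measurable_funTS; apply: G_meas_e_measurable.
Qed.

(** Cutting [X] along the bands [n <= X < n + 1] gives bounded pieces, to which the finite case
    applies; the versions are then summed. *)
Lemma is_cexp_nn_exists (X : T -> R) :
  measurable_fun setT X -> (forall x, 0 <= X x) ->
  exists g, is_cexp_nn P G (fun x => (X x)%:E) g.
Proof.
move=> mX X0.
pose D n := X @^-1` `[n%:R, n.+1%:R[%classic.
have mD n : measurable (D n).
  by rewrite -[D n]setTI; apply: mX => //; exact: measurable_itv.
pose Y n x := (X x * \1_(D n) x)%:E.
have mY n : measurable_fun setT (Y n).
  by apply/measurable_EFinP; apply: measurable_funM => //; exact: measurable_indic.
have Y0 n x : (0 <= Y n x)%E by rewrite lee_fin mulr_ge0.
have [g cg] : {g : nat -> T -> \bar R & forall n, is_cexp_nn P G (Y n) (g n)}.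
  apply: (@choice _ _ (fun n g => is_cexp_nn P G (Y n) g)) => n.
  apply: is_cexp_nn_finite_integral => //.
  apply: (@le_lt_trans _ _ (\int[P]_x (cst (n.+1%:R%:E) x))%E); last first.
    by rewrite integral_cst// [X in (_ * X)%E](@probability_setT _ T R P) mule1 ltry.
  apply: ge0_le_integral => //= x _; rewrite lee_fin indicE.
  have [|] := boolP (x \in D n); last by rewrite mulr0.
  by rewrite inE /D /= in_itv/= mulr1 => /andP[_ /ltW].
exists (fun x => \sum_(n <oo) g n x)%E.
suff -> : (fun x => (X x)%:E) = (fun x => \sum_(n <oo) Y n x)%E.
  exact: is_cexp_nn_series.
apply/funext => x.
rewrite (@nneseriesD1 _ _ (Num.truncn (X x)))//.
have trX := truncn_itv (X0 x).
rewrite eseries0 ?adde0.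
  by rewrite /Y indicE mem_set ?mulr1//=.
move=> i _ /= iX; rewrite /Y indicE memNset ?mulr0//.
rewrite /D/= in_itv/= => Xi.
by move: iX; rewrite (truncn_def Xi) eqxx.
Qed.

(** The set where [v < u] is covered by countably many sets of [G] on which [v <= p < q <= u] with
    [p], [q] rational. Integrating over such a set bounds [q] times its measure by [p] times its
    measure, so it is null; rational separation also copes with infinite values. *)
Lemma ae_le_of_integral_le (u v : T -> \bar R) :
  G_meas_e G u -> G_meas_e G v ->
  (forall x, (0 <= u x)%E) -> (forall x, (0 <= v x)%E) ->
  (forall A, G A -> (\int[P]_(x in A) u x <= \int[P]_(x in A) v x)%E) ->
  {ae P, forall x, (u x <= v x)%E}.
Proof.
move=> uG vG u0 v0 uv.
pose pq n : rat * rat := odflt (0, 0) (unpickle n).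
pose A n := if (pq n).1 < (pq n).2 then
  [set x | (v x <= (ratr (pq n).1)%:E)%E] `&`
  [set x | ((ratr (pq n).2)%:E <= u x)%E] else set0.
have GA n : G (A n).
  rewrite /A; case: ifP => _; last first.
    by apply/sub_measurableP; exact: measurable0.
  apply: G_setI; apply/sub_measurableP.
    rewrite -[X in measurable X]setTI.
    by apply: (@emeasurable_fun_infty_c _ T' R) => //; exact/G_meas_eP.
  rewrite -[X in measurable X]setTI.
  by apply: (@emeasurable_fun_c_infty _ T' R) => //; exact/G_meas_eP.
have mA n : measurable (A n) by exact: GM.
have PA n : P (A n) = 0%E.
  rewrite {1}/A; case: ifPn => pq12; last by rewrite measure0.
  set B := _ `&` _.
  have BA : B = A n by rewrite /A pq12.
  have mB : measurable B by rewrite BA.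
  have pfin : P B \is a fin_num by exact: fin_num_measure.
  have : ((ratr (pq n).2)%:E * P B <= (ratr (pq n).1)%:E * P B :> \bar R)%E.
    rewrite -!integral_cst//.
    have q0 : 0 <= ratr (pq n).1 :> R \/ B = set0.
      have [[x [xB _]]|] := pselect (B !=set0).
        by left; rewrite -lee_fin (le_trans (v0 x)).
      by move/set0P/negP/negPn/eqP; right.
    case: q0 => [q0|->]; last by rewrite !integral_set0.
    apply: (@le_trans _ _ (\int[P]_(x in B) u x)%E).
      apply: ge0_le_integral => //.
      - move=> x _; rewrite lee_fin (le_trans q0)// ler_rat.
        exact: ltW.
      - exact: measurable_funTS (G_meas_e_measurable uG).
      - by move=> x [].
    apply: le_trans.
      apply: uv; rewrite BA; exact: GA.
    apply: ge0_le_integral => //.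
    - exact: measurable_funTS (G_meas_e_measurable vG).
    - by move=> x [].
  move: pfin => /fineK <-; rewrite -!EFinM lee_fin => h.
  have Pge0 : 0 <= fine (P B) by rewrite fine_ge0.
  have pq12R : ratr (pq n).1 < ratr (pq n).2 :> R by rewrite ltr_rat.
  by congr EFin; nra.
suff : P.-negligible (\bigcup_n A n).
  apply: negligibleS => x /=; apply: contra_notP => nA; rewrite leNgt.
  apply/negP => vu; apply: nA.
  have [p [q [pq12 vp qu]]] : exists p q : rat,
      [/\ p < q, (v x <= (ratr p)%:E)%E & ((ratr q)%:E <= u x)%E].
    move: vu (v0 x) (u0 x).
    case: (v x) => [r| |]; case: (u x) => [s| |]//=; rewrite ?lte_fin.
    - move=> rs _ _.
      have [p pI] := rat_in_itvoo rs.
      move: pI; rewrite in_itv/= => /andP[rp ps].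
      have [q qI] := rat_in_itvoo ps.
      move: qI; rewrite in_itv/= => /andP[pltq qs].
      exists p, q; rewrite -(ltr_rat R) pltq; split => //; rewrite lee_fin ltW//.
    - move=> _ _ _.
      have r1 : r < r + 1 by rewrite ltrDl.
      have [p] := rat_in_itvoo r1; rewrite in_itv/= => /andP[rp p1].
      have [q] := rat_in_itvoo p1; rewrite in_itv/= => /andP[pltq _].
      by exists p, q; rewrite -(ltr_rat R) pltq lee_fin ltW// leey.
  exists (pickle (p, q)); first by [].
  by rewrite /A /pq pickleK [odflt _ _]/= pq12.
apply: negligible_bigcup => n.
by exists (A n); split; [exact: mA|exact: PA|exact: subset_refl].
Qed.

Lemma integral_mul_indic (D B : set T) (X : T -> R) :
  (\int[P]_(x in D) (X x * \1_B x)%:E = \int[P]_(x in D `&` B) (X x)%:E)%E.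
Proof.
rewrite integral_mkcondr; apply: eq_integral => x _.
by rewrite patchE indicE; case: ifPn => _; rewrite ?mulr1 ?mulr0.
Qed.

Lemma integral_mule_indic (D B : set T) (u : T -> \bar R) :
  (\int[P]_(x in D) (u x * (\1_B x)%:E) = \int[P]_(x in D `&` B) u x)%E.
Proof.
rewrite integral_mkcondr; apply: eq_integral => x _.
by rewrite patchE indicE; case: ifPn => _; rewrite ?mule1 ?mule0.
Qed.

Import HBNNSimple.

(** [h] is the increasing limit of simple functions on [T']. Their level sets lie in [G], where the
    hypothesis applies, and monotone convergence concludes. *)
Lemma integral_mul_eq (h u w : T -> R) :
  G_meas G h -> (forall x, 0 <= h x) ->
  measurable_fun setT u -> measurable_fun setT w ->
  (forall x, 0 <= u x) -> (forall x, 0 <= w x) ->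
  (forall A, G A ->
     (\int[P]_(x in A) (u x)%:E = \int[P]_(x in A) (w x)%:E)%E) ->
  (\int[P]_x (h x * u x)%:E = \int[P]_x (h x * w x)%:E)%E.
Proof.
move=> hG h0 mu mw u0 w0 uw.
have mh : measurable_fun (setT : set T') (EFin \o h : T' -> \bar R).
  by apply/measurable_EFinP; apply/G_measP.
pose f := nnsfun_approx (measurableT : measurable (setT : set T')) mh.
pose s n := (finmap.enum_fset (fset_set (range (f n)))).
have GB n y : G (f n @^-1` [set y]) by apply/sub_measurableP.
(* The absolute values make every coefficient visibly nonnegative; on values actually taken by [f n]
   they change nothing. *)
have expand (v : T -> R) : measurable_fun setT v -> (forall x, 0 <= v x) ->
    (\int[P]_x (h x * v x)%:E =
     limn (fun n => \sum_(y <- s n) (`|y|%:E * \int[P]_(x in f n @^-1` [set y]) (v x)%:E)))%E.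
  move=> mv v0.
  have mf n : measurable_fun (setT : set T) (f n).
    by apply: G_meas_measurable; apply/G_measP; exact: measurable_funP.
  have f0 n x : 0 <= f n x by [].
  transitivity (\int[P]_x (limn (fun n => (f n x * v x)%:E)))%E.
    apply: eq_integral => x _; apply/esym/cvg_lim => //.
    rewrite EFinM; under eq_fun do rewrite EFinM.
    apply: cvgeZr => //.
    apply: (@cvg_nnsfun_approx _ T' R setT measurableT _ mh) => // z _.
    by rewrite /= lee_fin.
  rewrite monotone_convergence//; first last.
  - move=> x _ a b ab; rewrite lee_fin ler_wpM2r//.
    by have /lefP := @nd_nnsfun_approx _ T' R setT measurableT _ mh a b ab; exact.
  - by move=> n x _; rewrite lee_fin mulr_ge0.
  - by move=> n; apply/measurable_EFinP; exact: measurable_funM.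
  apply/congr_lim/funext => n.
  transitivity (\int[P]_x (\sum_(y <- s n) (`|y| * (v x * \1_(f n @^-1` [set y]) x))%:E))%E.
    apply: eq_integral => x _; rewrite sumEFin; congr EFin.
    rewrite fimfunE fsbig_finite//= mulr_suml; apply: eq_big_seq => y.
    rewrite in_fset_set// inE => -[z _ <-].
    by rewrite ger0_norm// -mulrA [_ * v x]mulrC.
  rewrite ge0_integral_sum//.
  - apply: eq_bigr => y _.
    under eq_integral do rewrite EFinM.
    rewrite ge0_integralZl_EFin//.
    + by rewrite integral_mul_indic setTI.
    + by move=> x _; rewrite lee_fin mulr_ge0.
    + apply/measurable_EFinP; apply: measurable_funM => //.
      by apply: measurable_indic; exact: GM.
  - move=> y; apply/measurable_EFinP; apply: measurable_funM => //.
    apply: measurable_funM => //.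
    by apply: measurable_indic; exact: GM.
  - by move=> y x _; rewrite lee_fin !mulr_ge0.
by rewrite !expand//; apply/congr_lim/funext => n; apply: eq_bigr => y _; rewrite uw.
Qed.

(** Zero conditional mean gives the positive and negative parts of [X] equal integrals over sets of
    [G]. Splitting [h] as well reduces to [integral_mul_eq], and integrability of the product
    permits the final subtraction. *)
Lemma integral_mul_eq0 (h X : T -> R) :
  G_meas G h -> P.-integrable setT (EFin \o X) ->
  P.-integrable setT (fun x => (h x * X x)%:E) ->
  (forall A, G A -> (\int[P]_(x in A) (X x)%:E = 0)%E) ->
  (\int[P]_x (h x * X x)%:E = 0)%E.
Proof.
move=> hG iX ihX X0.
pose pos (f : T -> R) x := Num.max (f x) 0.
pose neg (f : T -> R) x := Num.max (- f x) 0.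
have posE (f : T -> R) : (EFin \o f)^\+%E = EFin \o pos f.
  by apply/funext => x; rewrite funeposE /= EFin_max.
have negE (f : T -> R) : (EFin \o f)^\-%E = EFin \o neg f.
  by apply/funext => x; rewrite funenegE /= EFin_max.
have pos0 f x : 0 <= pos f x by rewrite /pos le_max lexx orbT.
have neg0 f x : 0 <= neg f x by rewrite /neg le_max lexx orbT.
have mX : measurable_fun setT X by apply/measurable_EFinP; exact: measurable_int iX.
have mh : measurable_fun setT h by exact: G_meas_measurable.
have mpos f : measurable_fun setT f -> measurable_fun setT (pos f).
  by move=> mf; apply: measurable_maxr.
have mneg f : measurable_fun setT f -> measurable_fun setT (neg f).
  by move=> mf; apply: measurable_maxr => //; exact: measurableT_comp.
have Gpos : G_meas G (pos h).
  by apply/G_measP; apply: measurable_maxr => //; exact/G_measP.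
have Gneg : G_meas G (neg h).
  apply/G_measP; apply: measurable_maxr => //.
  by apply: measurableT_comp => //; exact/G_measP.
have Xpn A : G A ->
    (\int[P]_(x in A) (pos X x)%:E = \int[P]_(x in A) (neg X x)%:E)%E.
  move=> GA; 
  have iXA : P.-integrable A (EFin \o X).
    by apply: integrableS iX => //; exact: GM.
  have mA : measurable A by exact: GM.
  have := integrable_pos_fin_num mA iXA.
  have := integrable_neg_fin_num mA iXA.
  move: (X0 _ GA); rewrite [X in (X = 0)%E -> _]integralE posE negE => XA /fineK nE /fineK pE.
  by move: XA; rewrite -nE -pE => /eqP; rewrite -EFinB eqe subr_eq0 => /eqP ->.
have hXpE : (EFin \o (fun x => (h x * X x)%R))^\+%E =
    (fun x => (pos h x * pos X x)%R%:E + (neg h x * neg X x)%R%:E)%E.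
  apply/funext => x; rewrite funeposE /= -EFin_max -EFinD; congr EFin.
  exact: max0M.
have hXnE : (EFin \o (fun x => (h x * X x)%R))^\-%E =
    (fun x => (pos h x * neg X x)%R%:E + (neg h x * pos X x)%R%:E)%E.
  apply/funext => x; rewrite funenegE /= -EFin_max -EFinD; congr EFin.
  by rewrite -mulrN max0M opprK.
have e : (\int[P]_x (EFin \o (fun x => (h x * X x)%R))^\+ x =
          \int[P]_x (EFin \o (fun x => (h x * X x)%R))^\- x)%E.
  have mM (f g : T -> R) : measurable_fun setT f -> measurable_fun setT g ->
      measurable_fun setT (fun x : T => (f x * g x)%:E).
    by move=> mf mg; apply/measurable_EFinP; exact: measurable_funM.
  rewrite hXpE hXnE !ge0_integralD//; try (by move=> x _; rewrite lee_fin mulr_ge0);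
    try (by apply: mM; first [exact: mpos|exact: mneg]).
  by congr (_ + _)%E; apply: integral_mul_eq => //;
    try exact: mpos; try exact: mneg; move=> A GA; rewrite Xpn.
rewrite [LHS]integralE e subee//.
exact: integrable_neg_fin_num.
Qed.

Lemma cexp_nnP (X : T -> R) :
  measurable_fun setT X -> (forall x, 0 <= X x) ->
  is_cexp_nn P G (fun x => (X x)%:E) (cexp_nn P G (fun x => (X x)%:E)).
Proof.
move=> mX X0; rewrite /cexp_nn; case: pselect => [h|].
  exact: (proj2_sig (boolp.constructive_indefinite_description h)).
by case; exact: is_cexp_nn_exists.
Qed.

Lemma cexp_nn_ae_unique (X : T -> R) (g : T -> \bar R) :
  is_cexp_nn P G (fun x => (X x)%:E) g ->
  {ae P, forall x, cexp_nn P G (fun x => (X x)%:E) x = g x}.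
Proof.
move=> [gG [g0 gE]]; rewrite /cexp_nn; case: pselect => [h|]; last first.
  by case; exists g.
case: (proj2_sig (boolp.constructive_indefinite_description h)).
set g' := proj1_sig _ => gG' [g0' gE'].
have H1 : {ae P, forall x, (g' x <= g x)%E}.
  by apply: ae_le_of_integral_le => // A GA; rewrite gE// gE'.
have H2 : {ae P, forall x, (g x <= g' x)%E}.
  by apply: ae_le_of_integral_le => // A GA; rewrite gE// gE'.
by apply: filterS2 H1 H2 => x h1 h2; apply/eqP; rewrite eq_le h1 h2.
Qed.

Lemma cexp_nn_ae_le (X : T -> R) (g : T -> \bar R) :
  measurable_fun setT X -> (forall x, 0 <= X x) ->
  G_meas_e G g -> (forall x, (0 <= g x)%E) ->
  (forall A, G A -> (\int[P]_(x in A) (X x)%:E <= \int[P]_(x in A) g x)%E) ->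
  {ae P, forall x, (cexp_nn P G (fun x => (X x)%:E) x <= g x)%E}.
Proof.
move=> mX X0 gG g0 Xg; have [cG [c0 cE]] := cexp_nnP mX X0.
by apply: ae_le_of_integral_le => // A GA; rewrite cE// Xg.
Qed.

Lemma cexp_G_meas (f : T -> R) : G_meas G (cexp P G f).
Proof.
rewrite /cexp; case: pselect => [h|_]; last first.
  by apply/G_measP; exact: measurable_cst.
by case: (proj2_sig (boolp.constructive_indefinite_description h)).
Qed.

(** The set [B] where [g1 > g2] belongs to [G], so the nonnegative function [u], equal to [g1 - g2]
    on [B] and to 0 elsewhere, has integral zero over every set of [G]. *)
Lemma ae_le_of_integral_eq (g1 g2 : T -> R) :
  G_meas G g1 -> G_meas G g2 ->
  P.-integrable setT (EFin \o g1) -> P.-integrable setT (EFin \o g2) ->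
  (forall A, G A ->
    (\int[P]_(x in A) (g1 x)%:E = \int[P]_(x in A) (g2 x)%:E)%E) ->
  {ae P, forall x, g1 x <= g2 x}.
Proof.
move=> G1 G2 i1 i2 g12.
pose B := [set x | 0 < g1 x - g2 x].
have mB : measurable (B : set T').
  have m12 : measurable_fun (setT : set T') (fun x : T' => g1 x - g2 x).
    by apply: measurable_funB; exact/G_measP.
  rewrite (_ : B = setT `&` (fun x => g1 x - g2 x) @^-1` `]0, +oo[%classic).
    by apply: m12 => //; exact: measurable_itv.
  by apply/seteqP; split => x /=; rewrite in_itv/= andbT// => -[].
have GB : G B by apply/sub_measurableP.
pose u x := (g1 x - g2 x) * \1_B x.
have u0 x : 0 <= u x.
  rewrite /u indicE; have [|] := boolP (x \in B); rewrite ?mulr0 ?mulr1//.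
  by rewrite inE => /ltW.
have uG : G_meas_e G (EFin \o u).
  apply/G_meas_eP/measurable_EFinP; apply: measurable_funM.
    by apply: measurable_funB; exact/G_measP.
  exact: measurable_indic.
have H : {ae P, forall x, ((u x)%:E <= cst 0%E x)%E}.
  apply: ae_le_of_integral_le => //.
    by apply/G_meas_eP; exact: measurable_cst.
  move=> A GA; rewrite integral0 integral_mul_indic.
  have GAB : G (A `&` B) by exact: G_setI.
  have mAB := GM GAB.
  under eq_integral do rewrite EFinB.
  rewrite integralB//; try exact: (integrableS measurableT).
  rewrite g12// subee//.
  by apply: integrable_fin_num => //; exact: (integrableS measurableT).
apply: filterS H => x; rewrite lee_fin /u indicE.
have [|] := boolP (x \in B).
  by rewrite inE mulr1 subr_le0.
by rewrite notin_setE /B/= => /negP; rewrite -leNgt subr_le0.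
Qed.

Lemma cexp_ae_unique (f g : T -> R) : is_cexp P G f g ->
  {ae P, forall x, cexp P G f x = g x}.
Proof.
move=> [gG [ig gE]]; rewrite /cexp; case: pselect => [h|]; last first.
  by case; exists g.
case: (proj2_sig (boolp.constructive_indefinite_description h)).
set g' := proj1_sig _ => gG' [ig' gE'].
have H1 : {ae P, forall x, g' x <= g x}.
  by apply: ae_le_of_integral_eq => // A GA; rewrite gE// gE'.
have H2 : {ae P, forall x, g x <= g' x}.
  by apply: ae_le_of_integral_eq => // A GA; rewrite gE// gE'.
by apply: filterS2 H1 H2 => x h1 h2; apply/eqP; rewrite eq_le h1 h2.
Qed.

End SubSigmaAlgebra.

(** * Square-integrable martingales *)

Section MartingaleL2.
Context {d : measure_display} {T : measurableType d} {R : realType}.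
Variables (P : probability T R) (F : nat -> set (set T)).
Hypothesis hF : is_filtration F.

Let sF n : sigma_algebra setT (F n). Proof. by case: hF. Qed.
Let FM n A : F n A -> measurable A. Proof. by case: hF => _ [h _]; exact: h. Qed.
Let FS n m : (n <= m)%N -> F n `<=` F m.
Proof. by case: hF => _ [_ h]; exact: h. Qed.

Lemma G_meas_sub (n m : nat) (g : T -> R) :
  (n <= m)%N -> G_meas (F n) g -> G_meas (F m) g.
Proof. by move=> nm gn B mB; apply: (FS nm); exact: gn. Qed.

Lemma integrable_mul_of_sqr (f g : T -> R) :
  measurable_fun setT f -> measurable_fun setT g ->
  P.-integrable setT (fun x => (f x ^+ 2)%:E) ->
  P.-integrable setT (fun x => (g x ^+ 2)%:E) ->
  P.-integrable setT (fun x => (f x * g x)%:E).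
Proof.
move=> mf mg if2 ig2.
apply: (@le_integrable _ _ _ _ _ _ _ (fun x => (f x ^+ 2)%:E + (g x ^+ 2)%:E)%E) => //.
- by apply/measurable_EFinP; exact: measurable_funM.
- move=> x _; rewrite /= lee_fin ler_norml.
  rewrite ger0_norm ?addr_ge0 ?sqr_ge0//.
  by apply/andP; split; nra.
- exact: integrableD.
Qed.

Lemma integrable_of_sqr (f : T -> R) :
  measurable_fun setT f -> P.-integrable setT (fun x => (f x ^+ 2)%:E) ->
  P.-integrable setT (EFin \o f).
Proof.
move=> mf if2.
apply: (@le_integrable _ _ _ _ _ _ _ (fun x => (f x ^+ 2)%:E + cst 1%E x)%E) => //.
- exact/measurable_EFinP.
- move=> x _; rewrite /= lee_fin ler_norml.
  rewrite ger0_norm ?addr_ge0 ?sqr_ge0//.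
  by apply/andP; split; nra.
- apply: integrableD => //; exact: finite_measure_integrable_cst.
Qed.

Variable x : nat -> T -> R.
Hypothesis xF : forall i, G_meas (F i.+1) (x i).
Hypothesis x2 : forall i, P.-integrable setT (fun w => (x i w ^+ 2)%:E).
Hypothesis x0 : forall i A, F i A -> (\int[P]_(w in A) (x i w)%:E = 0)%E.

Let mx i : measurable_fun setT (x i).
Proof. by apply: (G_meas_measurable (@FM i.+1)). Qed.

Let ix i : P.-integrable setT (EFin \o x i).
Proof. exact: integrable_of_sqr. Qed.

Let g n w := \sum_(i < n) x i w.

Let gF n : G_meas (F n) (g n).
Proof.
apply/(G_measP (sF n)).
apply: (@measurable_sum _ (g_sigma_algebraType (F n)) R) => i.
by apply/(G_measP (sF n)); exact: G_meas_sub (xF i).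
Qed.

Let mg n : measurable_fun setT (g n).
Proof. exact: (G_meas_measurable (@FM n)). Qed.

Let ig n : P.-integrable setT (EFin \o g n).
Proof.
elim: n => [|n ih].
  rewrite (_ : _ \o _ = cst 0%E); first exact: integrable0.
  by apply/funext => w; rewrite /g/= big_ord0.
rewrite (_ : _ \o _ = (EFin \o g n) \+ (EFin \o x n))%E; last first.
  by apply/funext => w; rewrite /g/= big_ord_recr.
exact: integrableD.
Qed.

Let gconst n k A : F n A ->
  (\int[P]_(w in A) (g (n + k) w)%:E = \int[P]_(w in A) (g n w)%:E)%E.
Proof.
move=> FA; have mA := FM FA; elim: k => [|k ih]; first by rewrite addn0.
have igA : P.-integrable A (EFin \o g (n + k)) by exact: (integrableS measurableT).
have ixA : P.-integrable A (EFin \o x (n + k)) by exact: (integrableS measurableT).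
transitivity (\int[P]_(w in A) ((EFin \o g (n + k)) w + (EFin \o x (n + k)) w))%E.
  by apply: eq_integral => w _; rewrite addnS /g big_ord_recr.
rewrite integralD// [X in (_ + X)%E]x0 ?adde0 ?ih//.
by apply: FS FA; rewrite leq_addr.
Qed.

Let c i := fine (\int[P]_w (x i w ^+ 2)%:E)%E.

Let D n k w := \sum_(i < k) x (n + i) w.

(** Pythagoras for a block of increments: [D n k] is [F (n + k)]-measurable, hence orthogonal to the
    next increment [x (n + k)]. *)
Let D2 n k : P.-integrable setT (fun w => (D n k w ^+ 2)%:E) /\
  (\int[P]_w (D n k w ^+ 2)%:E = (\sum_(i < k) c (n + i))%:E)%E.
Proof.
elim: k => [|k [ih1 ih2]].
  rewrite big_ord0 (_ : (fun w => _) = cst 0%E); last first.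
    by apply/funext => w; rewrite /D big_ord0 expr0n.
  by split; [exact: integrable0|exact: integral0].
have DF : G_meas (F (n + k)) (D n k).
  apply/(G_measP (sF _)).
  apply: (@measurable_sum _ (g_sigma_algebraType (F (n + k))) R) => i.
  apply/(G_measP (sF _)); apply: G_meas_sub (xF (n + i)).
  by rewrite -addnS leq_add2l.
have mD : measurable_fun setT (D n k) by exact: (G_meas_measurable (@FM (n + k))).
have iDx := integrable_mul_of_sqr mD (mx (n + k)) ih1 (x2 (n + k)).
have Dx0 : (\int[P]_w (D n k w * x (n + k) w)%:E = 0)%E.
  by apply: (integral_mul_eq0 (sF (n + k)) (@FM (n + k))) => // A; exact: x0.
have -> : (fun w => (D n k.+1 w ^+ 2)%:E) =
    (fun w => (D n k w ^+ 2)%:E + (2%:E * (D n k w * x (n + k) w)%:E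
      + (x (n + k) w ^+ 2)%:E))%E.
  apply/funext => w; rewrite /D big_ord_recr/= -/(D n k w).
  by rewrite -EFinM -!EFinD; congr EFin; ring.
have i2 : P.-integrable setT (fun w => 2%:E * (D n k w * x (n + k) w)%:E)%E.
  exact: integrableZl.
split; first by apply: integrableD => //; exact: integrableD.
rewrite integralD//; last exact: integrableD.
rewrite integralD// integralZl// Dx0 mule0 add0e ih2 big_ord_recr/= EFinD.
by congr (_ + _)%E; rewrite fineK//; exact: integrable_fin_num.
Qed.

Variable K : R.
Hypothesis cK : forall n, \sum_(i < n) c i <= K.

Let c_ge0 i : 0 <= c i.
Proof. by apply/fine_ge0/integral_ge0 => w _; rewrite lee_fin sqr_ge0. Qed.

Let tail (e : R) : 0 < e ->
  exists N, forall n k, (N <= n)%N -> \sum_(i < k) c (n + i) <= e.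
Proof.
move=> e0.
have : cvgn (series c).
  apply: nondecreasing_is_cvgn.
    by apply: nondecreasing_series.
  by exists K => _ [n _ <-]; rewrite /series/= big_mkord.
move=> /cauchy_cvgP/cauchy_seriesP/(_ e e0).
move=> [[A B] [/= [N1 _ NA] [N2 _ NB]] AB].
exists (maxn N1 N2) => n k; rewrite geq_max => /andP[n1 n2].
have := AB (n, (n + k)%N); rewrite /= => /(_ _)/ltW h.
apply: (le_trans (ler_norm _)).
apply: (le_trans _ (h _)).
  rewrite -{2}[n]add0n big_addn addKn big_mkord.
  rewrite [X in _ <= `|X|](eq_bigr (fun i : 'I_k => c (n + i)))// => i _.
  by rewrite addnC.
by split; [exact: NA|apply: NB => /=; rewrite (leq_trans n2)// leq_addr].
Qed.

(** The rate [4^-j] for the L^2 tails yields differences of order [2^-j] in L^1 along the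
    subsequence, which are summable. *)
Let subseq : {m : nat -> nat | [/\ forall j, (j <= m j)%N,
  forall j, (m j <= m j.+1)%N &
  forall j n k, (m j <= n)%N -> \sum_(i < k) c (n + i) <= 4^-1 ^+ j]}.
Proof.
have [m hm] : {m : nat -> nat & forall j, forall n k, (m j <= n)%N ->
    \sum_(i < k) c (n + i) <= 4^-1 ^+ j}.
  apply: (@choice _ _ (fun j N => forall n k, (N <= n)%N ->
    \sum_(i < k) c (n + i) <= 4^-1 ^+ j)) => j.
  by apply: tail; rewrite exprn_gt0// invr_gt0.
exists (fun j => \sum_(i < j.+1) (m i).+1)%N; split=> [j|j|j n k mn].
- elim: j => [//|j ih]; rewrite big_ord_recr/=.
  by rewrite addnS ltnS (leq_trans ih)// leq_addr.
- by rewrite [leqRHS]big_ord_recr/= leq_addr.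
- apply: hm; apply: leq_trans mn; rewrite big_ord_recr/=.
  by rewrite (leq_trans (leqnSn _))// leq_addl.
Qed.

(** The limit along the fast subsequence is dominated by the integrable [B], so integrals pass to
    the limit. For [A] in [F n] the integrals of [g (m j)] over [A] no longer change once
    [m j >= n], which identifies the limit of the integrals. *)
Lemma l2_martingale_limit : exists a : T -> R,
  P.-integrable setT (EFin \o a) /\ forall n, is_cexp P (F n) a (g n).
Proof.
have [m [mj mS mc]] := subseq.
pose y j w := g (m j.+1) w - g (m j) w.
have my j : measurable_fun setT (y j) by exact: measurable_funB.
have yD j : y j = D (m j) (m j.+1 - m j).
  apply/funext => w; rewrite /y /D /g -(big_mkord xpredT (fun i => x i w)).
  rewrite -(big_mkord xpredT (fun i => x i w)) (@big_cat_nat _ _ _ (m j))//=.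
  rewrite addrAC subrr add0r -{1}[m j]add0n big_addn big_mkord.
  by apply: eq_bigr => i _; rewrite addnC.
(* Completing the square gives [|y| <= 2^j y^2 + 2^-j]; with an L^2 energy of at most [4^-j] the
   bound is twice [2^-j], written in the shape summed by [epsilon_trick0]. *)
have iy j : (\int[P]_w `|y j w|%:E <= (4 / (2 ^ j.+1)%:R)%:E)%E.
  have [iD2 D2E] := D2 (m j) (m j.+1 - m j).
  have t0 : 0 < 2 ^+ j :> R by rewrite exprn_gt0.
  apply: (@le_trans _ _ (\int[P]_w ((2 ^+ j)%:E * (y j w ^+ 2)%:E + cst (2 ^- j)%:E w))%E).
    apply: ge0_le_integral => //.
    - by apply/measurable_EFinP; exact: measurableT_comp.
    - apply: emeasurable_funD => //; apply/measurable_EFinP.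
      by apply: measurable_funM => //; exact: measurable_funX.
    - move=> w _; rewrite -EFinM -EFinD lee_fin -[y j w ^+ 2]real_normK ?num_real//.
      set z := `|_|; have -> : 2 ^+ j * z ^+ 2 + 2 ^- j =
          z + 2 ^+ j * ((z - 2 ^- j / 2) ^+ 2 + 3 / 4 * (2 ^- j) ^+ 2).
        by field; rewrite expf_neq0.
      by rewrite lerDl mulr_ge0 ?(ltW t0)// addr_ge0 ?sqr_ge0// mulr_ge0 ?sqr_ge0.
  rewrite yD integralD//; last 2 first.
  - exact: integrableZl.
  - exact: finite_measure_integrable_cst.
  rewrite integralZl// D2E integral_cst//.
  rewrite [X in (_ + _ * X)%E](@probability_setT _ T R P) mule1 -EFinM -EFinD lee_fin.
  have := mc j (m j) (m j.+1 - m j)%N (leqnn _).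
  set S := \sum_(i < _) _ => hS.
  apply: (@le_trans _ _ (2 ^+ j * 4^-1 ^+ j + 2 ^- j)).
    by rewrite lerD2r ler_wpM2l// ltW.
  have -> : 4^-1 ^+ j = 2 ^- j * 2 ^- j :> R.
    by rewrite -exprVn -exprMn; congr (_ ^+ j); field.
  rewrite mulrA mulfV ?mul1r ?gt_eqF// natrX exprS.
  by rewrite invfM mulrA; lra.
pose h w := (\sum_(j <oo) `|y j w|%:E)%E.
have mh : measurable_fun setT h.
  apply: ge0_emeasurable_sum => // j _; apply/measurable_EFinP.
  exact: measurableT_comp.
have h0 w : (0 <= h w)%E by apply: nneseries_ge0.
have ih : P.-integrable setT h.
  apply/integrableP; split=> //; under eq_integral do rewrite gee0_abs//.
  rewrite integral_nneseries//; last first.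
    by move=> j; apply/measurable_EFinP; exact: measurableT_comp.
  apply: (@le_lt_trans _ _ (4%:E)%E); last by rewrite ltry.
  apply: le_trans (epsilon_trick0 xpredT (_ : 0 <= 4)) => //.
  by apply: lee_nneseries => // j _ _; exact: integral_ge0.
pose E := [set w | h w \is a fin_num].
have mE : measurable E.
  rewrite (_ : E = setT `&` [set w | (h w < +oo)%E]).
    exact: emeasurable_fun_infty_o.
  by apply/seteqP; split => w; rewrite /E /= ge0_fin_numE// => -[].
have PE : {ae P, forall w, E w}.
  by apply: filterS (integrable_ae measurableT ih) => w; exact.
(* Multiplying by the indicator of [E] makes the sequence converge at every point, so that its limit
   is measurable. *)
pose b j w := g (m j) w * \1_E w.
have mb j : measurable_fun setT (b j).
  by apply: measurable_funM => //; exact: measurable_indic.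
have bcvg w : cvgn (b ^~ w).
  have [wE|wE] := pselect (E w); last first.
    rewrite (_ : b ^~ w = cst 0); first exact: is_cvg_cst.
    by apply/funext => j; rewrite /b indicE memNset// mulr0.
  have -> : b ^~ w = (fun j => g (m 0%N) w + series (y ^~ w) j).
    apply/funext => j; rewrite /b indicE mem_set// mulr1 /series/=.
    by rewrite telescope_sumr// addrC subrK.
  apply: is_cvgD; first exact: is_cvg_cst.
  apply: normed_cvg; apply: nondecreasing_is_cvgn.
    by apply: nondecreasing_series => j _ _; exact: normr_ge0.
  exists (fine (h w)) => _ [n _ <-]; rewrite /series/= -lee_fin fineK//.
  rewrite -sumEFin.
  by apply: nneseries_lim_ge => j _ _; rewrite lee_fin.
pose a w := limn (b ^~ w).
have ma : measurable_fun setT a.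
  by apply: (measurable_fun_cvg mb) => w _; exact: bcvg.
pose B w := (`|g (m 0%N) w|%:E + h w)%E.
have iB : P.-integrable setT B.
  by apply: integrableD => //; exact: (integrable_abse (ig (m 0%N))).
have bB j w : (`|(b j w)%:E| <= B w)%E.
  have [wE|wE] := pselect (E w); last first.
    by rewrite /b indicE memNset// mulr0 abse0 adde_ge0// lee_fin.
  rewrite /b indicE mem_set// mulr1 /=.
  have -> : g (m j) w = g (m 0%N) w + \sum_(0 <= i < j) y i w.
    by rewrite telescope_sumr// addrC subrK.
  apply: (@le_trans _ _ (`|g (m 0%N) w|%:E + \sum_(0 <= i < j) `|y i w|%:E)%E).
    rewrite sumEFin -EFinD lee_fin (le_trans (ler_normD _ _))// lerD2l.
    exact: ler_norm_sum.
  by rewrite leeD2l//; apply: nneseries_lim_ge => i _ _; rewrite lee_fin.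
have dom A : measurable A -> P.-integrable A (EFin \o a) /\
    ((\int[P]_(w in A) (b j w)%:E)%E @[j --> \oo] --> (\int[P]_(w in A) (a w)%:E)%E).
  move=> mA.
  have m1 j : measurable_fun A (EFin \o b j).
    by apply/measurable_EFinP; exact: measurable_funTS.
  have m2 : measurable_fun A (EFin \o a).
    by apply/measurable_EFinP; exact: measurable_funTS.
  have ab : \forall w \ae P, A w -> (EFin \o b j) w @[j --> \oo] --> (EFin \o a) w.
    apply: aeW => w _; apply: cvg_EFin; first exact: nearW.
    exact: bcvg.
  have bBA : \forall w \ae P, forall j, A w -> (`|(EFin \o b j) w| <= B w)%E.
    by apply: aeW => w j _; exact: bB.
  have iBA : P.-integrable A B by exact: (integrableS measurableT).
  by have [? _ ?] := dominated_convergence mA m1 m2 ab iBA bBA.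
exists a; split; first by case: (dom setT measurableT).
move=> n; split; [exact: gF|split; [exact: ig|move=> A FA]].
have mA := FM FA.
have [_ /cvg_lim <-//] := dom A mA.
apply/esym/cvg_lim => //; apply: cvg_near_cst; exists n => // j /= nj.
transitivity (\int[P]_(w in A) (g (m j) w)%:E)%E.
  apply: ae_eq_integral => //.
  - by apply/measurable_EFinP; exact: measurable_funTS.
  - by apply/measurable_EFinP; exact: measurable_funTS.
  - by apply: filterS PE => w wE _; rewrite /b indicE mem_set// mulr1.
by rewrite -(subnKC (leq_trans nj (mj j))) gconst.
Qed.

End MartingaleL2.

(** * Musielak-Orlicz quasi-norms *)

Section MusielakOrlicz.
Context {d : measure_display} {T : measurableType d} {R : realType}.
Variables (P : probability T R).

Import HBNNSimple.

(* The integral of a nonnegative function is a supremum over simple functions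
   below it, so monotonicity needs no measurability; [phi x (g x / lam)] may
   fail to be measurable since [phi x] is only monotone. *)
Lemma le_integral_ae (f g : T -> \bar R) :
  (forall x, (0 <= f x)%E) -> (forall x, (0 <= g x)%E) ->
  {ae P, forall x, (f x <= g x)%E} ->
  (\int[P]_x f x <= \int[P]_x g x)%E.
Proof.
move=> f0 g0 [N [mN PN fgN]].
rewrite !ge0_integralTE//; apply: ge_ereal_sup => _ [h hf <-].
(* Setting the simple function [h] to zero on the null set [N] keeps its integral and places it
   below [g] everywhere. *)
apply: (@le_trans _ _ (sintegral P (proj_nnsfun h (measurableC mN)))); last first.
  apply: ereal_sup_ubound; eexists; last by [].
  move=> x /=; rewrite mindicE.
  have [|] := boolP (x \in ~` N); rewrite ?mulr0 ?mulr1//.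
  rewrite inE => xN; apply: (le_trans (hf x)).
  by apply: contrapT => fg; apply: xN; apply: fgN.
rewrite -!integralT_nnsfun le_eqVlt; apply/orP; left; apply/eqP.
apply: ae_eq_integral => //.
- by apply/measurable_EFinP; exact: measurable_funP.
- by apply/measurable_EFinP; exact: measurable_funP.
exists N; split => // x /= /not_implyP[_]; apply: contra_notP => xN.
by rewrite mindicE mem_set// mulr1.
Qed.

Variable phi : T -> R -> R.
Hypothesis hphi : MO_function phi.

Let phi_ge0 x t : 0 <= t -> 0 <= phi x t.
Proof. by case: hphi => h _; exact: h. Qed.
Let phi_le x s t : 0 <= s -> s <= t -> phi x s <= phi x t.
Proof. by case: hphi => _ [h _]; exact: h. Qed.

Lemma modular_integrand_ge0 (lam : R) (g : T -> \bar R) x :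
  0 < lam -> (0 <= g x)%E ->
  (0 <= match g x with r%:E => (phi x (r / lam))%:E | _ => +oo end)%E.
Proof.
move=> lam0; case: (g x) => // r; rewrite !lee_fin => r0.
by rewrite phi_ge0// divr_ge0// ltW.
Qed.

Lemma le_phi_modular (lam : R) (g1 g2 : T -> \bar R) :
  0 < lam -> (forall x, (0 <= g1 x)%E) -> (forall x, (0 <= g2 x)%E) ->
  {ae P, forall x, (g1 x <= g2 x)%E} ->
  (phi_modular P phi lam g1 <= phi_modular P phi lam g2)%E.
Proof.
move=> lam0 g10 g20 g12; apply: le_integral_ae.
- by move=> x; exact: modular_integrand_ge0.
- by move=> x; exact: modular_integrand_ge0.
apply: filterS g12 => x; move: (g10 x) (g20 x).
case: (g1 x) => [r1| |]; case: (g2 x) => [r2| |]//=; rewrite ?leey// !lee_fin.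
by move=> r10 r20 r12; apply: phi_le; rewrite ?divr_ge0 ?ler_wpM2r ?invr_ge0// ltW.
Qed.

Lemma le_LMO_norm (g1 g2 : T -> \bar R) :
  (forall x, (0 <= g1 x)%E) -> (forall x, (0 <= g2 x)%E) ->
  {ae P, forall x, (g1 x <= g2 x)%E} ->
  (LMO_norm P phi g1 <= LMO_norm P phi g2)%E.
Proof.
move=> g10 g20 g12; apply: ereal_inf_le_tmp => _ [lam [lam0 gl] <-].
exists lam => //; split=> //; apply: le_trans gl.
exact: le_phi_modular.
Qed.

Lemma LMO_norm_ge0 (g : T -> \bar R) : (0 <= LMO_norm P phi g)%E.
Proof.
by apply: le_ereal_inf_tmp => _ [lam [lam0 _] <-]; rewrite lee_fin ltW.
Qed.

Lemma LMO_normZ (c : R) (g : T -> \bar R) :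
  0 < c -> (forall x, (0 <= g x)%E) ->
  (LMO_norm P phi (fun x => c%:E * g x) <= c%:E * LMO_norm P phi g)%E.
Proof.
move=> c0 g0; rewrite -lee_pdivrMl//.
apply: le_ereal_inf_tmp => _ [lam [lam0 gl] <-].
rewrite lee_pdivrMl//; apply: ereal_inf_lbound; exists (c * lam); last by [].
split; first exact: mulr_gt0.
apply: le_trans gl; rewrite le_eqVlt; apply/orP; left; apply/eqP.
apply: eq_integral => x _; have := g0 x; case: (g x) => [r _| _|]//.
  rewrite -EFinM; congr (phi _ _)%:E.
  by rewrite -mulf_div divff ?mul1r// gt_eqF.
by rewrite gt0_muley ?lte_fin.
Qed.

Lemma LMO_norm_lty_ex (g : T -> \bar R) (b : R) : (LMO_norm P phi g < b%:E)%E ->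
  exists lam, [/\ 0 < lam, lam < b & (phi_modular P phi lam g <= 1)%E].
Proof.
move=> /ereal_inf_lt[_ [lam [lam0 gl] <-]]; rewrite lte_fin => lamb.
by exists lam.
Qed.

Lemma measure0_of_integral_infty (A : set T) (r : R) : measurable A ->
  (\int[P]_(x in A) cst +oo x <= r%:E :> \bar R)%E -> P A = 0%E.
Proof.
move=> mA; apply: contraPP => /eqP PA.
rewrite integral_cst// gt0_mulye ?leye_eq//.
by rewrite lt0e PA measure_ge0.
Qed.

(** The modular integrand is [+oo] wherever [g] is, so a single [lam] with modular at most 1 forces
    that set to be null. *)
Lemma LMO_norm_lty_ae (g : T -> \bar R) :
  measurable_fun setT g -> (forall x, (0 <= g x)%E) ->
  (LMO_norm P phi g < +oo)%E -> {ae P, forall x, (g x < +oo)%E}.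
Proof.
move=> mg g0 gfin.
have [_ [lam [lam0 gl] <-] _] := ereal_inf_lt gfin.
pose A := [set x | (+oo <= g x)%E].
have mA : measurable A.
  by rewrite -[A]setTI; exact: emeasurable_fun_c_infty.
exists A; split => //; last first.
  by move=> x /=; rewrite /A/= ltNge => /negP; rewrite negbK.
apply: (@measure0_of_integral_infty _ 1) => //; apply: le_trans gl.
rewrite integral_mkcond; apply: le_integral_ae => [x|x|].
- by rewrite patchE; case: ifP => _ /=; [exact: leey|exact: lexx].
- exact: modular_integrand_ge0.
apply: aeW => x; rewrite patchE; case: ifPn => [|_]; last first.
  exact: modular_integrand_ge0.
by rewrite inE /A/= leye_eq => /eqP ->.
Qed.

(** A zero norm admits [lam] below every [1 / (n + 1)], so the integral of [phi x (n + 1)] over the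
    support is at most 1 for all [n]. Since [phi x] tends to infinity, monotone convergence bounds
    the integral of [+oo] over the support by 1. This settles the atoms whose normalisation
    degenerates. *)
Lemma ind_norm_eq0 (nu : T -> option nat) :
  measurable (Bset nu) -> ind_norm P phi nu = 0%E -> P (Bset nu) = 0%E.
Proof.
move=> mB n0; set B := Bset nu in mB *.
have intB n : (\int[P]_(x in B) (phi x n.+1%:R)%:E <= 1)%E.
  have : (ind_norm P phi nu < (n.+1%:R^-1)%:E)%E.
    by rewrite n0 lte_fin invr_gt0.
  move=> /LMO_norm_lty_ex[lam [lam0 lamn]]; apply: le_trans.
  rewrite integral_mkcond; apply: le_integral_ae => [x|x|].
  - by rewrite patchE; case: ifP => // _; rewrite lee_fin phi_ge0.
  - by rewrite lee_fin phi_ge0// divr_ge0// ltW.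
  apply: aeW => x; rewrite patchE -/B indicE; case: ifPn => xB.
    rewrite lee_fin phi_le// mul1r -[leLHS]invrK lef_pV2// ?posrE ?invr_gt0//.
    exact: ltW.
  by rewrite lee_fin phi_ge0// mul0r.
apply: (@measure0_of_integral_infty _ 1) => //.
have limy x : limn (fun n => (phi x n.+1%:R)%:E) = +oo%E.
  apply/cvg_lim => //; apply/cvgeryP.
  have [_ [_ [_ [cphi _]]]] := hphi.
  apply/cvgryPge => A; have /cvgryPge/(_ A) [M [_ HM]] := cphi x.
  near=> n; apply: HM.
  near: n; exists (Num.bound `|M|) => // n /= bn.
  apply: (le_lt_trans (ler_norm M)); apply: (lt_le_trans (archi_boundP (normr_ge0 M))).
  by rewrite ler_nat leqW.
rewrite (_ : cst _ = fun x => limn (fun n => (phi x n.+1%:R)%:E)); last first.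
  by apply/funext => x; rewrite limy.
have mphi n : measurable_fun B (fun x => (phi x n.+1%:R)%:E).
  apply/measurable_EFinP; apply: measurable_funTS.
  by have [_ [_ [_ [_ m]]]] := hphi; exact: m.
have nd x a b : (a <= b)%N -> ((phi x a.+1%:R)%:E <= (phi x b.+1%:R)%:E)%E.
  by move=> ab; rewrite lee_fin phi_le// ler_nat.
rewrite monotone_convergence//; first last.
- by move=> x _ a b; exact: nd.
- by move=> n x _; rewrite lee_fin phi_ge0.
apply: lime_le; last exact: nearW.
apply: ereal_nondecreasing_is_cvgn => a b ab.
apply: ge0_le_integral => // x _; last exact: nd.
by rewrite lee_fin phi_ge0.
Unshelve. all: by end_near. Qed.

End MusielakOrlicz.

(** * Series *)

Section SymmetricSums.

(* Enumerates the integers as 0, 1, -1, 2, -2, ..., so that the symmetric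
   partial sums over [-N, N] are initial partial sums. *)
Definition zigzag (j : nat) : int :=
  if odd j then (j./2.+1)%:Z else - (j./2)%:Z.

Lemma zigzag_bij : set_bij [set: nat] [set: int] zigzag.
Proof.
pose inv (z : int) := match z with
  | Posz 0 => 0%N | Posz n.+1 => n.*2.+1 | Negz n => n.+1.*2 end.
have zK : cancel zigzag inv.
  move=> j; rewrite /zigzag; have := odd_double_half j.
  case: (odd j) => /=; first by rewrite add1n.
  by rewrite add0n; case: (j./2) => [|n] // <-; rewrite -NegzE.
have Kz : cancel inv zigzag.
  case=> [[|n]|n] //=; rewrite /zigzag.
    by rewrite /= odd_double/= uphalf_double.
  by rewrite odd_double doubleK NegzE.
split=> // [j k _ _ /(can_inj zK)//|z _].
by exists (inv z) => //; rewrite Kz.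
Qed.

Lemma sum_symmetric_zigzag (V : nmodType) (g : int -> V) (N : nat) :
  \sum_(i < N.*2.+1) g (i%:Z - N%:Z) = \sum_(j < N.*2.+1) g (zigzag j).
Proof.
elim: N => [|N ih]; first by rewrite !big_ord1.
rewrite doubleS big_ord_recr big_ord_recl [RHS]big_ord_recr [in RHS]big_ord_recr/=.
rewrite -ih; set S := \sum_(i < _) _; set S' := \sum_(i < _) _.
have -> : S = S'.
  by apply: eq_bigr => i _; congr g; rewrite /bump/=; lia.
have -> : zigzag N.*2.+1 = N.+1%:Z.
  by rewrite /zigzag/= odd_double/= uphalf_double.
have -> : zigzag N.*2.+2 = - N.+1%:Z.
  by rewrite /zigzag/= odd_double/= doubleK.
rewrite sub0r (_ : N.*2.+2%:Z - _ = N.+1%:Z); last by rewrite -addnn; lia.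
by rewrite (addrC _ S') addrAC.
Qed.

Lemma esum_zigzag (R : realType) (g : int -> \bar R) :
  (forall k, (0 <= g k)%E) ->
  (\esum_(k in [set: int]) g k = \sum_(j <oo) g (zigzag j))%E.
Proof.
move=> g0; rewrite (reindex_esum [set: nat] [set: int] zigzag) ?nneseries_esumT//.
exact: zigzag_bij.
Qed.

End SymmetricSums.

Section Series.
Context {R : realType}.

(** Each [z j ^ r] is at most the full sum [S], and [1/r - 1 >= 0], so
    [z j = (z j ^ r)^(1/r - 1) * z j ^ r] is at most [S^(1/r - 1) * z j ^ r]; summing over [j] gives
    [S^(1/r)]. *)
Lemma nneseries_le_poweR (z : nat -> \bar R) (r : R) :
  0 < r -> r <= 1 -> (forall j, (0 <= z j)%E) ->
  (\sum_(j <oo) z j <= poweR (\sum_(j <oo) poweR (z j) r) r^-1)%E.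
Proof.
move=> r0 r1 z0; set S := (\sum_(j <oo) poweR _ _)%E.
have rN0 : r != 0 by rewrite gt_eqF.
have zr0 j : (0 <= poweR (z j) r)%E by exact: poweR_ge0.
have S0 : (0 <= S)%E by apply: nneseries_ge0.
have zS j : (poweR (z j) r <= S)%E.
  apply: (@le_trans _ _ (\sum_(0 <= i < j.+1) poweR (z i) r)%E).
    by rewrite big_nat_recr//= leeDr// sume_ge0.
  exact: nneseries_lim_ge.
case E : S S0 zS => [s| |]// s0 zS; last by rewrite poweRyr ?invr_neq0// leey.
rewrite lee_fin in s0.
have zle j : (z j <= (s `^ (r^-1 - 1))%:E * poweR (z j) r)%E.
  have := zS j; have := z0 j; case: (z j) => [x| |]//=; last first.
    by rewrite (negbTE rN0) leye_eq.
  rewrite !lee_fin => x0 xs.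
  have [->|xN0] := eqVneq x 0; first by rewrite mulr_ge0 ?powR_ge0.
  have xgt0 : 0 < x by rewrite lt_def xN0.
  have {1}-> : x = (x `^ r) `^ (r^-1 - 1) * x `^ r.
    rewrite -[X in _ * X](powRr1 (powR_ge0 _ _)) -powRD; last first.
      by rewrite subrK invr_eq0 (negbTE rN0).
    by rewrite subrK -powRrM mulfV// powRr1.
  rewrite ler_wpM2r ?powR_ge0// ge0_ler_powR ?nnegrE ?powR_ge0//.
  by rewrite subr_ge0 invf_ge1.
apply: (@le_trans _ _ (\sum_(j <oo) ((s `^ (r^-1 - 1))%:E * poweR (z j) r))%E).
  exact: lee_nneseries.
rewrite nneseriesZl// -/S E -EFinM lee_fin.
have [->|sN0] := eqVneq s 0; first by rewrite mulr0 powR_ge0.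
rewrite -[X in _ * X](powRr1 s0) -powRD ?subrK//.
by rewrite sN0 implybT.
Qed.

(** Cauchy-Schwarz without roots or quotients. The right-hand side stays an expanded double sum so
    that its terms can later be conditioned one at a time. *)
Lemma sum_sqr_le (n : nat) (x p q : nat -> R) :
  (forall i, 0 <= p i) -> (forall i, 0 <= q i) ->
  (forall i, x i ^+ 2 <= p i * q i) ->
  (\sum_(i < n) x i) ^+ 2 <= \sum_(k < n) \sum_(l < n) p k * q l.
Proof.
move=> p0 q0 xpq.
have key k l : x k * x l <= (p k * q l + p l * q k) / 2.
  rewrite ler_pdivlMr//.
  have [neg|pos] := leP (x k * x l) 0.
    by apply: (@le_trans _ _ 0); [nra|rewrite addr_ge0 ?mulr_ge0].
  have lhs0 : 0 <= x k * x l * 2 by rewrite mulr_ge0 ?(ltW pos).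
  have rhs0 : 0 <= p k * q l + p l * q k by rewrite addr_ge0 ?mulr_ge0.
  (* After squaring, this is the arithmetic-geometric inequality for [p k * q l] and [p l * q k],
     whose product dominates the square of [x k * x l]. *)
  rewrite -(@ler_pXn2r _ 2%N)//.
  have h : (x k * x l) ^+ 2 <= (p k * q l) * (p l * q k).
    rewrite exprMn (_ : _ * _ * (_ * _) = (p k * q k) * (p l * q l)); last by ring.
    by rewrite ler_pM ?sqr_ge0.
  by have := sqr_ge0 (p k * q l - p l * q k); nra.
rewrite [leRHS](_ : _ = \sum_(k < n) \sum_(l < n) (p k * q l + p l * q k) / 2).
  rewrite expr2 mulr_suml; apply: ler_sum => k _.
  by rewrite mulr_sumr; apply: ler_sum => l _.
have e : \sum_(k < n) \sum_(l < n) p k * q l =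
    \sum_(k < n) \sum_(l < n) p l * q k by rewrite exchange_big.
rewrite [RHS](_ : _ = (\sum_(k < n) \sum_(l < n) p k * q l
    + \sum_(k < n) \sum_(l < n) p l * q k) / 2); first by rewrite -e; lra.
rewrite -big_split/= mulr_suml; apply: eq_bigr => k _.
by rewrite -big_split/= mulr_suml.
Qed.

End Series.

(** * From atoms to the conditional square function *)

Section SquareFunction.
Context {d : measure_display} {T : measurableType d} {R : realType}.
Variables (P : probability T R) (F : nat -> set (set T)).
Hypothesis hF : is_filtration F.

Let sF n : sigma_algebra setT (F n). Proof. by case: hF. Qed.
Let FM n A : F n A -> measurable A. Proof. by case: hF => _ [h _]; exact: h. Qed.
Let FS n m : (n <= m)%N -> F n `<=` F m.
Proof. by case: hF => _ [_ h]; exact: h. Qed.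

Lemma stopping_time_le (nu : T -> option nat) (i : nat) :
  stopping_time F nu -> F i [set x | exists2 n, (n <= i)%N & nu x = Some n].
Proof.
move=> st; rewrite (_ : [set _ | _] = \bigcup_(n in [set n | (n <= i)%N]) [set x | nu x = Some n]).
  apply/(sub_measurableP (sF i)).
  apply: bigcup_measurable => n /= ni; apply/(sub_measurableP (sF i)).
  exact: FS (st n).
by apply/seteqP; split => x /= [n ni nux]; exists n.
Qed.

Lemma measurable_Bset (nu : T -> option nat) :
  stopping_time F nu -> measurable (Bset nu).
Proof.
move=> st; rewrite (_ : Bset nu = \bigcup_n [set x | nu x = Some n]).
  by apply: bigcup_measurable => n _; exact: FM (st n).
apply/seteqP; split => x /=; last first.
  by move=> [n _ nux]; rewrite /Bset/= nux.
by rewrite /Bset/=; case E: (nu x) => [n|] // _; exists n.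
Qed.

Variable f : nat -> T -> R.
Hypothesis fF : forall n, G_meas (F n) (f n).

Definition cond_var (i : nat) : T -> \bar R :=
  cexp_nn P (F i) (fun y => ((f i.+1 y - f i y) ^+ 2)%:E).

Lemma measurable_adapted n : measurable_fun setT (f n).
Proof. exact: (G_meas_measurable (@FM n)). Qed.

Lemma measurable_diff_sqr i :
  measurable_fun setT (fun y => (f i.+1 y - f i y) ^+ 2).
Proof.
by apply: measurable_funX; apply: measurable_funB; exact: measurable_adapted.
Qed.

Lemma cond_varP i :
  is_cexp_nn P (F i) (fun y => ((f i.+1 y - f i y) ^+ 2)%:E) (cond_var i).
Proof.
apply: (@cexp_nnP _ _ _ P _ (sF i) (@FM i) (fun y => (f i.+1 y - f i y) ^+ 2)); first exact: measurable_diff_sqr.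
by move=> x; exact: sqr_ge0.
Qed.

Lemma cond_var_ge0 i x : (0 <= cond_var i x)%E.
Proof. by have [_ [h _]] := cond_varP i. Qed.

Lemma cond_var_adapted i : G_meas_e (F i) (cond_var i).
Proof. by have [h _] := cond_varP i. Qed.

Lemma measurable_cond_var i : measurable_fun setT (cond_var i).
Proof. by apply: (G_meas_e_measurable (@FM i)); exact: cond_var_adapted. Qed.

Lemma cond_var_integral i A : F i A ->
  (\int[P]_(x in A) cond_var i x =
   \int[P]_(x in A) ((f i.+1 x - f i x) ^+ 2)%:E)%E.
Proof. by have [_ [_ h]] := cond_varP i; exact: h. Qed.

Lemma sqfunE : sqfun P F f = fun x => sqrte (\sum_(i <oo) cond_var i x)%E.
Proof. by []. Qed.

Lemma ge0_integral_eq0_ae (A : set T) (u : T -> \bar R) :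
  measurable A -> measurable_fun setT u -> (forall x, (0 <= u x)%E) ->
  (\int[P]_(x in A) u x = 0)%E -> {ae P, forall x, A x -> u x = 0%E}.
Proof.
move=> mA mu u0 iu.
have := @ae_eq_integral_abs _ _ _ P A mA u (measurable_funTS mu).
by under eq_integral do rewrite gee0_abs//; move=> [+ _]; apply.
Qed.

(** Over a set of [F i], the squared increment and its conditional variance are nonnegative with
    equal integrals, so one vanishes almost everywhere exactly when the other does. *)
Lemma cond_var_eq0 i A : F i A ->
  {ae P, forall x, A x -> f i.+1 x - f i x = 0} <->
  {ae P, forall x, A x -> cond_var i x = 0%E}.
Proof.
move=> FA; have mA := FM FA; split=> h.
  apply: ge0_integral_eq0_ae => //; [exact: measurable_cond_var|
    exact: cond_var_ge0|].
  rewrite cond_var_integral// -[RHS](integral0 P A).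
  apply: ae_eq_integral => //.
    by apply/measurable_EFinP/measurable_funTS; exact: measurable_diff_sqr.
  by apply: filterS h => x h Ax; rewrite h// expr0n.
have : {ae P, forall x, A x -> ((f i.+1 x - f i x) ^+ 2)%:E = 0%E}.
  apply: ge0_integral_eq0_ae => //.
  - by apply/measurable_EFinP; exact: measurable_diff_sqr.
  - by move=> x; rewrite lee_fin sqr_ge0.
  rewrite -cond_var_integral// -[RHS](integral0 P A).
  by apply: ae_eq_integral => //; apply: measurable_funTS; exact: measurable_cond_var.
apply: filterS => x h1 Ax; have [] := h1 Ax.
by move/eqP; rewrite sqrf_eq0 => /eqP.
Qed.

End SquareFunction.

(** * Almost everywhere bound of s(f) by the weights of the atoms *)

Section AtomicUpperBound.
Context {d : measure_display} {T : measurableType d} {R : realType}.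
Variables (P : probability T R) (F : nat -> set (set T)).
Hypothesis hF : is_filtration F.

Let sF n : sigma_algebra setT (F n). Proof. by case: hF. Qed.
Let FM n A : F n A -> measurable A. Proof. by case: hF => _ [h _]; exact: h. Qed.

Variables (f : nat -> T -> R) (mu beta : nat -> R) (a : nat -> nat -> T -> R).
Variable nu : nat -> T -> option nat.
Hypothesis fF : forall n, G_meas (F n) (f n).
Hypothesis aF : forall j n, G_meas (F n) (a j n).
Hypothesis mu0 : forall j, 0 <= mu j.
Hypothesis beta0 : forall j, 0 <= beta j.
Hypothesis st : forall j, stopping_time F (nu j).
Hypothesis a_eq0 : forall j n,
  {ae P, forall x, nu_ge (nu j) n x -> a j n x = 0}.
Hypothesis a_le : forall j, {ae P, forall x, Bset (nu j) x ->
  (sqfun P F (a j) x <= (beta j)%:E)%E}.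
Hypothesis a_cvg : forall n, {ae P, forall x,
  \sum_(j < N.*2.+1) mu j * a j n x @[N --> \oo] --> f n x}.

Let v j i := cond_var P F (a j) i.
Let v_ge0 j i x : (0 <= v j i x)%E.
Proof. exact: (cond_var_ge0 P hF (aF j)). Qed.

Let past j i : set T := [set x | exists2 n, (n <= i)%N & nu j x = Some n].

Let Fpast j i : F i (past j i).
Proof. exact: stopping_time_le. Qed.

Let nu_ge_past j i x : ~ past j i x -> nu_ge (nu j) i.+1 x.
Proof.
rewrite /nu_ge /past/=; case: (nu j x) => // n h.
by rewrite ltnNge; apply/negP => ni; apply: h; exists n.
Qed.

Let nu_ge_pred j i x : nu_ge (nu j) i.+1 x -> nu_ge (nu j) i x.
Proof. by rewrite /nu_ge; case: (nu j x) => // n /ltnW. Qed.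

Let diff_eq0 j i :
  {ae P, forall x, ~ past j i x -> a j i.+1 x - a j i x = 0}.
Proof.
apply: filterS2 (a_eq0 j i) (a_eq0 j i.+1) => x h0 h1 /nu_ge_past h.
by rewrite h0 ?h1 ?subr0//; exact: nu_ge_pred.
Qed.

Let v_eq0 j i : {ae P, forall x, ~ past j i x -> v j i x = 0%E}.
Proof.
have [H _] := @cond_var_eq0 _ _ _ P F hF _ (aF j) i _ (G_setC (sF i) (Fpast j i)).
by apply: H; exact: diff_eq0.
Qed.

(** On [Bset (nu j)] this is the squared atom bound. Elsewhere [nu j] is infinite, no [past j i]
    contains the point, and every conditional variance vanishes. *)
Let v_sum j : {ae P, forall x,
  (\sum_(i <oo) v j i x <= (beta j ^+ 2 * \1_(Bset (nu j)) x)%:E)%E}.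
Proof.
apply: filterS2 (a_le j) (ae_foralln (v_eq0 j)) => x h1 h2.
rewrite indicE; have [xB|xB] := boolP (x \in Bset (nu j)).
  rewrite mulr1; have := h1 (set_mem xB); rewrite sqfunE => h.
  have : (sqrte (\sum_(i <oo) v j i x) <= sqrte (beta j ^+ 2)%:E)%E.
    by rewrite /= sqrtr_sqr ger0_norm.
  by rewrite lee_sqrt// lee_fin sqr_ge0.
rewrite mulr0 eseries0// => i _ _; apply: h2 => -[n ni nux].
by move/negP: xB; apply; rewrite inE /Bset/= nux.
Qed.

(** For [beta j = 0] both weights [p] and [q] are zero, as the inverse of 0 is 0; the bound [pq]
    then holds only because the increments themselves vanish. *)
Let diff_eq0_beta j i : beta j = 0 ->
  {ae P, forall x, a j i.+1 x - a j i x = 0}.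
Proof.
move=> b0.
have [_ H] := @cond_var_eq0 _ _ _ P F hF _ (aF j) i _ (G_setT (sF i)).
have : {ae P, forall x, [set: T] x -> a j i.+1 x - a j i x = 0}.
  apply: H; apply: filterS (v_sum j) => x; rewrite b0 expr0n mul0r => h _.
  apply/eqP; rewrite eq_le; apply/andP; split; last exact: v_ge0.
  apply: le_trans h.
  apply: (@le_trans _ _ (\sum_(0 <= l < i.+1) v j l x)%E).
    rewrite big_nat_recr//= leeDr// sume_ge0//.
  exact: nneseries_lim_ge.
by apply: filterS => x; exact.
Qed.

(** On [past j i] the product of [p] and [q] is the squared increment of [mu j * a j]. The inverse
    [beta] in [q] is cancelled later by the factor [beta ^ 2] of [v_sum]. *)
Let p k i x := mu k * beta k * \1_(past k i) x.
Let q l i x := mu l * (beta l)^-1 * (a l i.+1 x - a l i x) ^+ 2.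

Let p0 k i x : 0 <= p k i x. Proof. by rewrite /p !mulr_ge0. Qed.
Let q0 l i x : 0 <= q l i x.
Proof. by rewrite /q mulr_ge0 ?sqr_ge0// mulr_ge0 ?invr_ge0. Qed.

Let pq j i : {ae P, forall x,
  (mu j * (a j i.+1 x - a j i x)) ^+ 2 <= p j i x * q j i x}.
Proof.
have [b0|bN0] := eqVneq (beta j) 0.
  apply: filterS (diff_eq0_beta i b0) => x ->.
  by rewrite mulr0 expr0n mulr_ge0.
apply: filterS (diff_eq0 j i) => x h.
rewrite /p /q indicE; have [xB|xB] := boolP (x \in past j i).
  rewrite mulr1 le_eqVlt; apply/orP; left; apply/eqP; by field.
rewrite h ?mulr0 ?expr0n ?mul0r//.
by move=> xp; move/negP: xB; apply; rewrite inE.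
Qed.

Let diff_le i : {ae P, forall x, (((f i.+1 x - f i x) ^+ 2)%:E <=
  \sum_(k <oo) \sum_(l <oo) (p k i x * q l i x)%:E)%E}.
Proof.
have PQ := ae_foralln (fun j => pq j i).
apply: filterS3 (a_cvg i) (a_cvg i.+1) PQ => x c0 c1 hpq.
pose S N := \sum_(j < N.*2.+1) mu j * (a j i.+1 x - a j i x).
have cS : S N ^+ 2 @[N --> \oo] --> (f i.+1 x - f i x) ^+ 2.
  have cS1 : S N @[N --> \oo] --> f i.+1 x - f i x.
    rewrite (_ : S = fun N => \sum_(j < N.*2.+1) mu j * a j i.+1 x -
        \sum_(j < N.*2.+1) mu j * a j i x); first exact: cvgB.
    by apply/funext => N; rewrite -sumrB; apply: eq_bigr => j _; rewrite mulrBr.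
  by rewrite expr2; under eq_fun do rewrite expr2; exact: cvgM.
have cE : (S N ^+ 2)%:E @[N --> \oo] --> ((f i.+1 x - f i x) ^+ 2)%:E.
  by apply: cvg_EFin cS; exact: nearW.
rewrite -(cvg_lim _ cE)//; apply: lime_le; first by apply/cvg_ex; eexists; exact: cE.
apply: nearW => N.
apply: (@le_trans _ _ (\sum_(k < N.*2.+1) \sum_(l < N.*2.+1) (p k i x * q l i x))%:E).
  by rewrite lee_fin; apply: (@sum_sqr_le R _ (fun j => mu j * (a j i.+1 x - a j i x)) (fun k => p k i x) (fun k => q k i x)).
rewrite -sumEFin.
apply: (@le_trans _ _ (\sum_(0 <= k < N.*2.+1) \sum_(l <oo) (p k i x * q l i x)%:E)%E).
  rewrite big_mkord; apply: lee_sum => k _; rewrite -sumEFin.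
  rewrite -(big_mkord xpredT (fun l => (p k i x * q l i x)%:E)).
  by apply: nneseries_lim_ge => l _ _; rewrite lee_fin mulr_ge0.
apply: nneseries_lim_ge => k _ _; apply: nneseries_ge0 => l _ _.
by rewrite lee_fin mulr_ge0.
Qed.

(** A version of the conditional expectation of [p k i * q l i] given [F i]: the indicator of
    [past k i] factors out. *)
Let w i k l x := ((mu k * beta k * \1_(past k i) x)%:E *
  ((mu l * (beta l)^-1)%:E * v l i x))%E.

Let w0 i k l x : (0 <= w i k l x)%E.
Proof.
by rewrite /w !mule_ge0 ?lee_fin ?mulr_ge0 ?invr_ge0.
Qed.

Let wF i k l : G_meas_e (F i) (w i k l).
Proof.
apply/(G_meas_eP (sF i)); apply: emeasurable_funM.
  apply/measurable_EFinP; apply: measurable_funM => //.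
  by apply: measurable_indic; apply/(sub_measurableP (sF i)).
apply: emeasurable_funM => //; apply/(G_meas_eP (sF i)).
exact: (cond_var_adapted P hF (aF l)).
Qed.

Let sum_w_F i :
  G_meas_e (F i) (fun x => \sum_(k <oo) \sum_(l <oo) w i k l x)%E.
Proof.
apply/(G_meas_eP (sF i)).
apply: (@ge0_emeasurable_sum _ (g_sigma_algebraType (F i)) R) => [k x _ _|k _].
  by apply: nneseries_ge0 => l _ _; exact: w0.
apply: (@ge0_emeasurable_sum _ (g_sigma_algebraType (F i)) R) => [l x _ _|l _].
  exact: w0.
exact/(G_meas_eP (sF i)).
Qed.

Let integral_pq i k l A : F i A ->
  (\int[P]_(x in A) (p k i x * q l i x)%:E = \int[P]_(x in A) w i k l x)%E.
Proof.
move=> FA; have mA := FM FA.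
have FAp : F i (A `&` past k i) by exact: (G_setI (sF i)).
have c0 : 0 <= mu k * beta k * (mu l * (beta l)^-1).
  by rewrite !mulr_ge0 ?invr_ge0.
have mdl := measurable_diff_sqr hF (aF l) i.
have mpast : measurable (past k i) by exact: FM (Fpast k i).
transitivity ((mu k * beta k * (mu l * (beta l)^-1))%:E *
   \int[P]_(x in A `&` past k i) ((a l i.+1 x - a l i x) ^+ 2)%:E)%E.
  rewrite -integral_mul_indic -ge0_integralZl_EFin//.
  - by apply: eq_integral => x _; rewrite -EFinM /p /q; congr EFin; ring.
  - by move=> x _; rewrite lee_fin mulr_ge0 ?sqr_ge0.
  - apply/measurable_EFinP/measurable_funTS.
    by apply: measurable_funM; [exact: mdl|exact: measurable_indic].
rewrite -(cond_var_integral P hF (aF l))// -integral_mule_indic.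
rewrite -ge0_integralZl_EFin//.
- apply: eq_integral => x _; rewrite /w -/(v l i); set z := v l i x.
  rewrite [(z * _)%E]muleC (EFinM (mu k * beta k) (mu l / beta l)) muleACA.
  by rewrite -EFinM.
- move=> x _; rewrite mule_ge0 ?lee_fin//.
  exact: v_ge0.
- apply: measurable_funTS; apply: emeasurable_funM.
    exact: (measurable_cond_var P hF (aF l)).
  by apply/measurable_EFinP; exact: measurable_indic.
Qed.

Let cond_var_le i : {ae P, forall x,
  (cond_var P F f i x <= \sum_(k <oo) \sum_(l <oo) w i k l x)%E}.
Proof.
apply: (@cexp_nn_ae_le _ _ _ P _ (sF i) (@FM i) (fun y => (f i.+1 y - f i y) ^+ 2)).
- exact: (measurable_diff_sqr hF fF).
- by move=> x; exact: sqr_ge0.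
- exact: sum_w_F.
- by move=> x; apply: nneseries_ge0 => k _ _; apply: nneseries_ge0.
move=> A FA; have mA := FM FA.
have mpq k l : measurable_fun A (fun x => (p k i x * q l i x)%:E).
  apply/measurable_EFinP/measurable_funTS; apply: measurable_funM.
    apply: measurable_funM => //; apply: measurable_indic.
    exact: FM (Fpast k i).
  by apply: measurable_funM => //; exact: (measurable_diff_sqr hF (aF l)).
have mw k l : measurable_fun A (w i k l).
  by apply: measurable_funTS; exact: (G_meas_e_measurable (@FM i)).
have pq0 k l x : (0 <= (p k i x * q l i x)%:E)%E by rewrite lee_fin mulr_ge0.
apply: (@le_trans _ _
    (\int[P]_(x in A) \sum_(k <oo) \sum_(l <oo) (p k i x * q l i x)%:E)%E).
  apply: ae_ge0_le_integral => //.
  - by move=> x _; rewrite lee_fin sqr_ge0.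
  - apply/measurable_EFinP/measurable_funTS.
    exact: (measurable_diff_sqr hF fF).
  - by move=> x _; apply: nneseries_ge0 => k _ _; exact: nneseries_ge0.
  - apply: ge0_emeasurable_sum => [k x _ _|k _]; first exact: nneseries_ge0.
    exact: ge0_emeasurable_sum.
  - by apply: filterS (diff_le i) => x h _.
have mpqS k : measurable_fun A (fun x => \sum_(l <oo) (p k i x * q l i x)%:E)%E.
  exact: ge0_emeasurable_sum.
have mwS k : measurable_fun A (fun x => \sum_(l <oo) w i k l x)%E.
  by apply: ge0_emeasurable_sum.
have pqS0 k x : A x -> (0 <= \sum_(l <oo) (p k i x * q l i x)%:E)%E.
  by move=> _; exact: nneseries_ge0.
have wS0 k x : A x -> (0 <= \sum_(l <oo) w i k l x)%E.
  by move=> _; exact: nneseries_ge0.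
rewrite !integral_nneseries//.
rewrite le_eqVlt; apply/orP; left; apply/eqP; apply: eq_eseriesr => k _.
by rewrite !integral_nneseries//; apply: eq_eseriesr => l _; rewrite integral_pq.
Qed.

Lemma sqfun_le_atomic_sum : {ae P, forall x, (sqfun P F f x <=
  \sum_(j <oo) (mu j * beta j * \1_(Bset (nu j)) x)%:E)%E}.
Proof.
apply: filterS2 (ae_foralln cond_var_le) (ae_foralln v_sum) => x hv hs.
set C := (\sum_(j <oo) _)%E.
have c0 j : (0 <= (mu j * beta j * \1_(Bset (nu j)) x)%:E)%E.
  by rewrite lee_fin !mulr_ge0.
have C0 : (0 <= C)%E by exact: nneseries_ge0.
case E : C C0 => [c| |]// C0; last by rewrite leey.
(* [c ^ 2] expands into the double series over [k] and [l] of products of weights, so the estimate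
   can be made for each pair after moving the sum over [i] inside. *)
suff h : (\sum_(i <oo) cond_var P F f i x <= (c ^+ 2)%:E)%E.
  rewrite sqfunE -[c]ger0_norm// -sqrtr_sqr.
  by rewrite -[leRHS]/(sqrte (c ^+ 2)%:E) lee_sqrt// lee_fin sqr_ge0.
apply: (@le_trans _ _ (\sum_(i <oo) \sum_(k <oo) \sum_(l <oo) w i k l x)%E).
  apply: lee_nneseries => [i _ _|i _]; last exact: hv.
  exact: (cond_var_ge0 P hF fF).
rewrite nneseries_interchange; last by move=> i k; exact: nneseries_ge0.
rewrite expr2 EFinM -{2}E /C -nneseriesZl//.
rewrite [leRHS](_ : _ = \sum_(k <oo) ((mu k * beta k * \1_(Bset (nu k)) x)%:E * C))%E; last first.
  by apply: eq_eseriesr => k _; rewrite muleC E.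
apply: lee_nneseries => [k _ _|k _].
  by apply: nneseries_ge0 => i _ _; exact: nneseries_ge0.
rewrite nneseries_interchange// -nneseriesZl//.
apply: lee_nneseries => [l _ _|l _]; first exact: nneseries_ge0.
have ml0 : 0 <= mu l * (beta l)^-1 by rewrite mulr_ge0 ?invr_ge0.
(* Enlarging [past k i] to [Bset (nu k)] frees the first factor from [i]. The sum over [i] then
   meets only [v l i], and [v_sum] turns the inverse of [beta l] into [beta l]. *)
apply: (@le_trans _ _ (\sum_(i <oo) ((mu k * beta k * \1_(Bset (nu k)) x)%:E *
    ((mu l * (beta l)^-1)%:E * v l i x)))%E).
  apply: lee_nneseries => // i _; apply: lee_wpmul2r.
    by rewrite mule_ge0 ?lee_fin//; exact: v_ge0.
  rewrite lee_fin ler_wpM2l ?mulr_ge0// !indicE ler_nat.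
  have [|//] := boolP (x \in past k i); rewrite inE => -[n _ nux].
  by rewrite mem_set// /Bset/= nux.
rewrite nneseriesZl; last first.
  by move=> i _; rewrite mule_ge0 ?lee_fin//; exact: v_ge0.
rewrite lee_wpmul2l// nneseriesZl; last first.
  by move=> i _; exact: v_ge0.
apply: le_trans (lee_wpmul2l _ (hs l)) _; first by rewrite lee_fin.
rewrite -EFinM lee_fin le_eqVlt; apply/orP; left; apply/eqP.
have [->|bN0] := eqVneq (beta l) 0; first by rewrite expr0n/= !(mulr0, mul0r).
by field.
Qed.

End AtomicUpperBound.

Lemma Hs_norm_le_Hat_norm (d : measure_display) (T : measurableType d)
    (R : realType) (P : probability T R) (F : nat -> set (set T))
    (phi : T -> R -> R) (r : R) (f : nat -> T -> R) :
  is_filtration F -> MO_function phi -> 0 < r -> r <= 1 ->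
  (forall n, G_meas (F n) (f n)) ->
  (Hs_norm P F phi f <= Hat_norm P F phi r f)%E.
Proof.
move=> hF hphi r0 r1 fF; apply: le_ereal_inf_tmp => _ [mu [a [nu [[mu0 [at_ cvg_]] ->]]]].
have sF n : sigma_algebra setT (F n) by case: hF.
have b0 k : (0 <= (ind_norm P phi (nu k))^-1)%E by rewrite inve_ge0 LMO_norm_ge0.
(* [fine] sends an infinite inverse, arising from a zero norm, to 0. The corresponding [Bset] is
   null, so the atom bound still holds almost everywhere, and the final comparison only uses
   [betaE]. *)
pose beta j : R := fine (ind_norm P phi (nu (zigzag j)))^-1%E.
have beta0 j : 0 <= beta j by exact: fine_ge0.
have betaE j : ((beta j)%:E <= (ind_norm P phi (nu (zigzag j)))^-1)%E.
  by rewrite /beta; move: (b0 (zigzag j)); case: (_^-1)%E => [x| |]//= _; rewrite leey.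
have st j : stopping_time F (nu (zigzag j)) by case: (at_ (zigzag j)).
apply: le_LMO_norm => //.
- by move=> x; rewrite sqfunE sqrte_ge0.
- by move=> x; exact: poweR_ge0.
have := @sqfun_le_atomic_sum _ _ _ P F hF f (mu \o zigzag) beta
  (fun j n => cexp P (F n) (a (zigzag j))) (nu \o zigzag) fF
  (fun j n => cexp_G_meas P (sF n) (a (zigzag j))) (fun j => mu0 _) beta0 st.
case=> [j n|j|n|].
- by have [_ [_ [h _]]] := at_ (zigzag j); exact: h.
- have [_ [_ [_ h]]] := at_ (zigzag j).
  have [n0|nN0] := eqVneq (ind_norm P phi (nu (zigzag j))) 0%E.
    exists (Bset (nu (zigzag j))); split.
    + exact: (measurable_Bset hF).
    + by apply: (ind_norm_eq0 hphi) => //; exact: (measurable_Bset hF).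
    + by move=> x /= /not_implyP[].
  apply: filterS h => x h xB; rewrite fineK ?h//.
  rewrite ge0_fin_numE// ltey; apply: contra nN0 => /eqP e.
  by rewrite -[ind_norm _ _ _]inveK e.
- apply: filterS (cvg_ n) => x h.
  move: h; apply: cvg_trans.
  apply: near_eq_cvg; apply: nearW => N /=.
  by rewrite (sum_symmetric_zigzag (fun z => mu z * cexp P (F n) (a z) x)).
move=> N [mN PN sN]; exists N; split => // x /= nx; apply: sN => /= h; apply: nx.
apply: (le_trans h).
pose z k := ((mu k)%:E * (\1_(Bset (nu k)) x)%:E * (ind_norm P phi (nu k))^-1)%E.
have z0 k : (0 <= z k)%E by rewrite /z !mule_ge0 ?lee_fin.
apply: (@le_trans _ _ (\sum_(j <oo) z (zigzag j))%E).
  apply: lee_nneseries => [j _ _|j _]; first by rewrite lee_fin !mulr_ge0 ?mu0.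
  rewrite mulrAC EFinM EFinM /z lee_wpmul2l//.
  by rewrite mule_ge0 ?lee_fin ?mu0.
apply: (le_trans (nneseries_le_poweR r0 r1 _)) => //.
by rewrite -(esum_zigzag (fun k => poweR_ge0 (z k) r)).
Qed.

(** * Atomic decomposition *)

Section GeometricSum.
Context {R : realType}.
Variable r : R.
Hypothesis r0 : 0 < r.

Let rho : R := 2 `^ r.

Let rho_gt1 : 1 < rho.
Proof.
have : 1 `^ r < 2 `^ r :> R by rewrite gt0_ltr_powR ?nnegrE// ltr1n.
by rewrite powR1.
Qed.

(* The sum of [2^((k+1)r)] over all [k] with [2^k < s] is at most this constant
   times [s^r]. *)
Definition dyadic_const : R := rho ^+ 2 / (rho - 1).

Lemma dyadic_const_gt0 : 0 < dyadic_const.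
Proof. by rewrite divr_gt0 ?subr_gt0 ?exprn_gt0// (lt_trans ltr01). Qed.

Lemma dyadic_sum_le (s : R) (N M : nat) : 0 <= s ->
  \sum_(i < M) (if (2 : R) ^ (i%:Z - N%:Z) < s
    then (2 ^ (i%:Z - N%:Z + 1)) `^ r else 0) <= dyadic_const * s `^ r.
Proof.
move=> s0; pose u (i : nat) : R := (2 ^ (i%:Z - N%:Z)) `^ r.
have rho0 : 0 < rho by rewrite (lt_trans ltr01).
have rho1 : 0 < rho - 1 by rewrite subr_gt0.
have uE (i : nat) : (2 ^ (i%:Z - N%:Z + 1)) `^ r = rho * u i.
  by rewrite expfzDr// expr1z mulrC powRM// exprz_ge0.
have uS i : u i.+1 = rho * u i.
  by rewrite -uE /u; congr (powR (exprz _ _) _); lia.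
have u0 i : 0 <= u i by exact: powR_ge0.
(* The induction carries a second bound, the full geometric sum [rho / (rho - 1) * u M] of the
   levels below [M]. When level [M] is active, adding [rho * u M] gives exactly
   [dyadic_const * u M], and [u M] is at most [s ^ r]. *)
suff [] : \sum_(i < M) (if (2 : R) ^ (i%:Z - N%:Z) < s
    then (2 ^ (i%:Z - N%:Z + 1)) `^ r else 0) <= rho / (rho - 1) * u M /\
  \sum_(i < M) (if (2 : R) ^ (i%:Z - N%:Z) < s
    then (2 ^ (i%:Z - N%:Z + 1)) `^ r else 0) <= dyadic_const * s `^ r by [].
have c0 : 0 <= rho / (rho - 1) by rewrite divr_ge0 ?ltW.
elim: M => [|M [ih1 ih2]].
  rewrite !big_ord0; split; rewrite mulr_ge0 ?powR_ge0//.
  exact: ltW dyadic_const_gt0.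
rewrite !big_ord_recr/=; case: ifPn => [ts|_]; last first.
  rewrite !addr0; split=> //; apply: (le_trans ih1); rewrite ler_wpM2l//.
  by rewrite uS ler_peMl// ltW.
rewrite uE.
have h : rho / (rho - 1) * u M + rho * u M = dyadic_const * u M.
  by rewrite /dyadic_const; field; rewrite gt_eqF.
have h1 : \sum_(i < M) (if (2 : R) ^ (i%:Z - N%:Z) < s
    then (2 ^ (i%:Z - N%:Z + 1)) `^ r else 0) + rho * u M <= dyadic_const * u M.
  by rewrite -h lerD2r.
split; apply: (le_trans h1).
  rewrite uS le_eqVlt; apply/orP; left; apply/eqP.
  by rewrite /dyadic_const; field; rewrite gt_eqF.
rewrite ler_wpM2l ?(ltW dyadic_const_gt0)// /u ge0_ler_powR ?nnegrE ?exprz_ge0//.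
  exact: ltW.
exact: ltW.
Qed.

End GeometricSum.

Section AtomicDecomposition.
Context {d : measure_display} {T : measurableType d} {R : realType}.
Variables (P : probability T R) (F : nat -> set (set T)).
Hypothesis hF : is_filtration F.

Let sF n : sigma_algebra setT (F n). Proof. by case: hF. Qed.
Let FM n A : F n A -> measurable A. Proof. by case: hF => _ [h _]; exact: h. Qed.
Let FS n m : (n <= m)%N -> F n `<=` F m.
Proof. by case: hF => _ [_ h]; exact: h. Qed.

Variables (phi : T -> R -> R) (f : nat -> T -> R).
Hypothesis hphi : MO_function phi.
Hypothesis hf : martingale P F f.
Hypothesis Hs_fin : (Hs_norm P F phi f < +oo)%E.

Let f0 x : f 0%N x = 0. Proof. by case: hf. Qed.
Let fF n : G_meas (F n) (f n). Proof. by case: hf => _ [h _]; exact: h. Qed.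
Let fi n : P.-integrable setT (EFin \o f n).
Proof. by case: hf => _ [_ [h _]]; exact: h. Qed.
Let fE n A : F n A ->
  (\int[P]_(x in A) (f n x)%:E = \int[P]_(x in A) (f n.+1 x)%:E)%E.
Proof. by case: hf => _ [_ [_ h]]; have [_ [_ e]] := h n; exact: e. Qed.

Let v := cond_var P F f.
Let v0 i x : (0 <= v i x)%E. Proof. exact: (cond_var_ge0 P hF fF). Qed.

Let S n x := (\sum_(i < n) v i x)%E.

Let S_ge0 n x : (0 <= S n x)%E. Proof. exact: sume_ge0. Qed.

Let S_le n m x : (n <= m)%N -> (S n x <= S m x)%E.
Proof.
move=> nm; rewrite /S -!(big_mkord xpredT (fun i => v i x)).
exact: lee_sum_nneg_natr.
Qed.

Let S_lim n x : (S n x <= \sum_(i <oo) v i x)%E.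
Proof.
by rewrite /S -(big_mkord xpredT (fun i => v i x)); exact: nneseries_lim_ge.
Qed.

Let S_sub n : measurable_fun setT (S n.+1 : g_sigma_algebraType (F n) -> \bar R).
Proof.
apply: (@emeasurable_sum _ (g_sigma_algebraType (F n)) R) => i.
apply/(G_meas_eP (sF n)) => B mB.
by apply: (@FS i); [rewrite -ltnS; exact: ltn_ord|exact: (cond_var_adapted P hF fF)].
Qed.

Let FSle n (c : R) : F n [set x | (S n.+1 x <= c%:E)%E].
Proof.
apply/(sub_measurableP (sF n)); rewrite -[X in measurable X]setTI.
exact: (@emeasurable_fun_infty_c _ (g_sigma_algebraType (F n)) R).
Qed.

Let FSgt n (c : R) : F n [set x | (c%:E < S n.+1 x)%E].
Proof.
apply/(sub_measurableP (sF n)); rewrite -[X in measurable X]setTI.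
exact: (@emeasurable_fun_o_infty _ (g_sigma_algebraType (F n)) R).
Qed.

Let t (k : int) : R := 2 ^ k.
Let theta (k : int) : R := t k ^+ 2.

Let t_gt0 k : 0 < t k. Proof. exact: exprz_gt0. Qed.
Let tS k : t (k + 1) = 2 * t k.
Proof. by rewrite /t expfzDr// expr1z mulrC. Qed.
Let theta_ge0 k : 0 <= theta k. Proof. exact: sqr_ge0. Qed.
Let thetaS k : theta k <= theta (k + 1).
Proof.
rewrite /theta ler_sqr ?nnegrE ?(ltW (t_gt0 _))// tS.
by rewrite ler_peMl ?(ltW (t_gt0 _))// ler1n.
Qed.

(* [S n.+1] is [F n]-measurable, which makes the index of its first passage
   above [4 ^ k] a stopping time. *)
Let nu (k : int) (x : T) : option nat :=
  match pselect (exists n, ((theta k)%:E < S n.+1 x)%E) with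
  | left h => Some (ex_minn h) | right _ => None end.

Let nu_geP k n x :
  nu_ge (nu k) n x <-> forall i, (i < n)%N -> (S i.+1 x <= (theta k)%:E)%E.
Proof.
rewrite /nu_ge /nu; case: pselect => [h|h]; last first.
  by split=> // _ i _; rewrite leNgt; apply/negP => ?; apply: h; exists i.
case: ex_minnP => m Sm mmin; split=> [nm i ni|H].
  rewrite leNgt; apply/negP => /mmin mi.
  by have := leq_trans (leq_trans ni nm) mi; rewrite ltnn.
by rewrite leqNgt; apply/negP => /H; rewrite leNgt Sm.
Qed.

Let BsetP k x : Bset (nu k) x <-> exists n, ((theta k)%:E < S n.+1 x)%E.
Proof. by rewrite /Bset /nu/=; case: pselect => h; split. Qed.

Let nu_stop k : stopping_time F (nu k).
Proof.
move=> n; rewrite (_ : [set _ | _] =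
    [set x | ((theta k)%:E < S n.+1 x)%E] `&` [set x | (S n x <= (theta k)%:E)%E]).
  apply: (G_setI (sF n)); first exact: FSgt.
  (* [S n.+1] is already measurable at time [n]; at time 0 the empty sum satisfies the condition
     everywhere. *)
  case: n => [|n]; last exact: (FS (leqnSn n)).
  rewrite (_ : [set _ | _] = setT); first exact: (G_setT (sF 0%N)).
  by apply/seteqP; split => // x _ /=; rewrite /S big_ord0 lee_fin.
apply/seteqP; split=> x /=.
  rewrite /nu; case: pselect => // h; case: ex_minnP => m Sm mmin [<-]; split=> //.
  case: m Sm mmin => [|m] Sm mmin; first by rewrite /S big_ord0 lee_fin.
  by rewrite leNgt; apply/negP => /mmin; rewrite ltnn.
move=> [Sn Sn']; rewrite /nu; case: pselect => [h|[]]; last by exists n.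
case: ex_minnP => m Sm mmin; congr Some; apply/eqP.
rewrite eqn_leq mmin// andTb leqNgt; apply/negP => mn.
by move: Sm; rewrite ltNge (le_trans (S_le x mn)).
Qed.

(** The event that [nu k <= i < nu (k + 1)], on which the stopped martingales at the two levels have
    different increments at step [i + 1]. *)
Let dyad (k : int) (i : nat) : set T :=
  [set x | ((theta k)%:E < S i.+1 x)%E] `&`
  [set x | (S i.+1 x <= (theta (k + 1))%:E)%E].

Let Fdyad k i : F i (dyad k i).
Proof. by apply: (G_setI (sF i)); [exact: FSgt|exact: FSle]. Qed.

Let mdyad k i : measurable (dyad k i). Proof. exact: FM (Fdyad k i). Qed.

Let diff i x := f i.+1 x - f i x.

Let mdiff i : measurable_fun setT (diff i).
Proof. by apply: measurable_funB; exact: (measurable_adapted hF fF). Qed.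

Let xi k i x := diff i x * \1_(dyad k i) x.

Let xi_sqr k i x : xi k i x ^+ 2 = diff i x ^+ 2 * \1_(dyad k i) x.
Proof.
by rewrite /xi exprMn indicE; case: (x \in _); rewrite ?expr1n ?expr0n.
Qed.

Let xi_adapted k i : G_meas (F i.+1) (xi k i).
Proof.
apply/(G_measP (sF i.+1)); apply: measurable_funM.
  apply: measurable_funB; apply/(G_measP (sF i.+1)) => //.
  by move=> B mB; apply: (FS (leqnSn i)); exact: fF.
by apply: measurable_indic; apply/(sub_measurableP (sF i.+1));
  exact: (FS (leqnSn i)).
Qed.

Let mxi2 k i : measurable_fun setT (fun x => (xi k i x ^+ 2)%:E).
Proof.
apply/measurable_EFinP; apply: measurable_funX.
by apply: measurable_funM; [exact: mdiff|exact: measurable_indic].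
Qed.

Let xi2E k i A : F i A -> (\int[P]_(x in A) (xi k i x ^+ 2)%:E =
  \int[P]_(x in A) (v i x * (\1_(dyad k i) x)%:E))%E.
Proof.
move=> FA; rewrite integral_mule_indic (cond_var_integral P hF fF); last first.
  exact: (G_setI (sF i)).
by rewrite -integral_mul_indic; apply: eq_integral => x _; rewrite xi_sqr.
Qed.

(** At the last index belonging to [dyad], the whole sum [S] up to and including that index is still
    at most [theta (k + 1)], and later terms are zero. The bound holds at every point. *)
Let v_dyad_sum k n x :
  (\sum_(i < n) (v i x * (\1_(dyad k i) x)%:E) <= (theta (k + 1))%:E)%E.
Proof.
elim: n => [|n ih]; first by rewrite big_ord0 lee_fin.
rewrite big_ord_recr/= indicE; have [xD|xD] := boolP (x \in dyad k n); last first.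
  by rewrite mule0 adde0.
move: xD; rewrite inE => -[_ /= Sn]; apply: le_trans Sn.
rewrite mule1 /S big_ord_recr/=; apply: leeD => //.
apply: lee_sum => i _; rewrite indicE.
by case: (x \in _); rewrite ?mule1 ?mule0.
Qed.

Let mvd k i : measurable_fun setT (fun x => v i x * (\1_(dyad k i) x)%:E)%E.
Proof.
apply: emeasurable_funM; first exact: (measurable_cond_var P hF fF).
by apply/measurable_EFinP; exact: measurable_indic.
Qed.

Let vd0 k i x : (0 <= v i x * (\1_(dyad k i) x)%:E)%E.
Proof. by rewrite mule_ge0// lee_fin. Qed.

Let sum_xi2 k n :
  (\sum_(i < n) \int[P]_x (xi k i x ^+ 2)%:E <= (theta (k + 1))%:E)%E.
Proof.
rewrite (eq_bigr (fun i : 'I_n => \int[P]_x (v i x * (\1_(dyad k i) x)%:E))%E); last first.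
  by move=> i _; rewrite xi2E//; exact: (G_setT (sF i)).
rewrite -ge0_integral_sum//.
apply: (@le_trans _ _ (\int[P]_x (cst (theta (k + 1))%:E x))%E).
  apply: ge0_le_integral => //.
  - by move=> x _; exact: sume_ge0.
  - exact: emeasurable_sum.
  - by move=> x _; exact: v_dyad_sum.
by rewrite integral_cst// [X in (_ * X)%E](@probability_setT _ T R P) mule1.
Qed.

Let int_xi2_le k i : (\int[P]_x (xi k i x ^+ 2)%:E <= (theta (k + 1))%:E)%E.
Proof.
apply: le_trans (sum_xi2 k i.+1); rewrite big_ord_recr/= leeDr//.
by apply: sume_ge0 => j _; apply: integral_ge0 => x _; rewrite lee_fin sqr_ge0.
Qed.

Let ixi2 k i : P.-integrable setT (fun x => (xi k i x ^+ 2)%:E).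
Proof.
apply/integrableP; split; first exact: mxi2.
under eq_integral do rewrite gee0_abs ?lee_fin ?sqr_ge0//.
by apply: le_lt_trans (int_xi2_le k i) _; rewrite ltry.
Qed.

Let xi_eq0 k i A : F i A -> (\int[P]_(x in A) (xi k i x)%:E = 0)%E.
Proof.
move=> FA; rewrite integral_mul_indic.
have FAD : F i (A `&` dyad k i) by exact: (G_setI (sF i)).
have mAD := FM FAD.
under eq_integral do rewrite EFinB.
have if1 : P.-integrable (A `&` dyad k i) (EFin \o f i.+1) by exact: (integrableS measurableT).
have if0 : P.-integrable (A `&` dyad k i) (EFin \o f i) by exact: (integrableS measurableT).
rewrite integralB// -fE// subee//.
exact: integrable_fin_num.
Qed.

Let g k n x := \sum_(i < n) xi k i x.

Let limit_ex k : exists a : T -> R,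
  P.-integrable setT (EFin \o a) /\ forall n, is_cexp P (F n) a (g k n).
Proof.
apply: (@l2_martingale_limit _ _ _ P F hF (xi k) (xi_adapted k) (ixi2 k)
  (@xi_eq0 k) (theta (k + 1))) => n.
rewrite -lee_fin -sumEFin; apply: le_trans (sum_xi2 k n).
apply: lee_sum => i _; rewrite fineK//; exact: integrable_fin_num.
Qed.

Let h k : T -> R := projT1 (cid (limit_ex k)).

Let hi k : P.-integrable setT (EFin \o h k).
Proof. by rewrite /h; case: cid => a []. Qed.

Let hE k n : is_cexp P (F n) (h k) (g k n).
Proof. by rewrite /h; case: cid => a []. Qed.

Let sqf_ge0 x : (0 <= sqfun P F f x)%E. Proof. exact: sqrte_ge0. Qed.

Let BsetE k x : Bset (nu k) x <-> ((t k)%:E < sqfun P F f x)%E.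
Proof.
have tE : (t k)%:E = sqrte (theta k)%:E.
  by rewrite /= sqrtr_sqr gtr0_norm.
rewrite tE sqfunE ltNge lee_sqrt ?lee_fin// -ltNge BsetP.
split=> [[n Sn]|Sx]; first exact: lt_le_trans (S_lim n.+1 x).
apply: contrapT => /forallNP nS; move: Sx; rewrite ltNge => /negP; apply.
apply: lime_le; first exact: is_cvg_nneseries.
apply: nearW => -[|n]; first by rewrite big_geq// lee_fin.
by rewrite big_mkord leNgt; apply/negP; exact: nS.
Qed.

Let N k := ind_norm P phi (nu k).

(** A Chebyshev argument: the indicator of [Bset (nu k)] is at most [s(f) / t k], and s(f) has
    finite norm. *)
Let N_fin k : N k \is a fin_num.
Proof.
rewrite ge0_fin_numE; last exact: LMO_norm_ge0.
apply: (@le_lt_trans _ _ (((t k)^-1)%:E * Hs_norm P F phi f)%E); last first.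
  by rewrite lte_mul_pinfty// lee_fin invr_ge0 ltW.
apply: (@le_trans _ _ (LMO_norm P phi (fun x => ((t k)^-1)%:E * sqfun P F f x)%E)); last first.
  by apply: LMO_normZ => //; rewrite invr_gt0.
apply: le_LMO_norm => //.
  by move=> x; rewrite mule_ge0// lee_fin invr_ge0 ltW.
apply: aeW => x; rewrite indicE; have [|] := boolP (x \in Bset (nu k)); last first.
  by move=> _; rewrite mule_ge0// lee_fin invr_ge0 ltW.
by rewrite inE => /BsetE/ltW h1; rewrite lee_pdivlMl// mule1.
Qed.

Let N0 k : 0 <= fine (N k).
Proof. by apply: fine_ge0; exact: LMO_norm_ge0. Qed.

Let mu k : R := t (k + 1) * fine (N k).

Let mu0 k : 0 <= mu k. Proof. by rewrite mulr_ge0// ltW. Qed.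

Let a k x := (mu k)^-1 * h k x.

Let ai k : P.-integrable setT (EFin \o a k).
Proof.
rewrite (_ : _ \o _ = (fun x => ((mu k)^-1)%:E * (EFin \o h k) x)%E); last first.
  by apply/funext.
exact: integrableZl.
Qed.

Let aE k n : is_cexp P (F n) (a k) (fun x => (mu k)^-1 * g k n x).
Proof.
have [gG [gi gE]] := hE k n; split; last split.
- apply/(G_measP (sF n)); apply: measurable_funM => //.
  exact/(G_measP (sF n)).
- rewrite (_ : _ \o _ = (fun x => ((mu k)^-1)%:E * (EFin \o g k n) x)%E); last first.
    by apply/funext.
  exact: integrableZl.
move=> A FA; have mA := FM FA.
have iA u : P.-integrable setT (EFin \o u) -> P.-integrable A (EFin \o u).
  exact: (integrableS measurableT).
under eq_integral do rewrite EFinM.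
under [RHS]eq_integral do rewrite EFinM.
rewrite (integralZl mA (iA _ gi)) (integralZl mA (iA _ (hi k))).
by congr (_ * _)%E; exact: gE.
Qed.

Let cexp_a k n : {ae P, forall x, cexp P (F n) (a k) x = (mu k)^-1 * g k n x}.
Proof. exact: (cexp_ae_unique (sF n) (@FM n) (aE k n)). Qed.

Let g_eq0 k n x : nu_ge (nu k) n x -> g k n x = 0.
Proof.
move=> /nu_geP H; apply: big1 => i _; rewrite /xi indicE memNset ?mulr0//.
by move=> [/= + _]; rewrite ltNge H.
Qed.

Let atom k : is_atom P F phi (a k) (nu k).
Proof.
split; first exact: nu_stop.
split; first exact: ai.
split=> [n|].
  by apply: filterS (cexp_a k n) => x -> /g_eq0 ->; rewrite mulr0.
(* For a zero norm the required bound is [+oo]. *)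
have [n0|nN0] := eqVneq (fine (N k)) 0.
  apply: aeW => x _; rewrite -/(N k) -(fineK (N_fin k)) n0 inve0; exact: leey.
have muN0 : mu k != 0 by rewrite mulf_neq0// gt_eqF.
pose X i x := (cexp P (F i.+1) (a k) x - cexp P (F i) (a k) x) ^+ 2.
have XE i : {ae P, forall x, X i x = (mu k) ^- 2 * xi k i x ^+ 2}.
  apply: filterS2 (cexp_a k i) (cexp_a k i.+1) => x h1 h2.
  by rewrite /X h1 h2 /g big_ord_recr/= -mulrBr addrAC subrr add0r exprMn exprVn.
have mX i : measurable_fun setT (X i).
  by apply: measurable_funX; apply: measurable_funB;
    apply: (G_meas_measurable (@FM _)); exact: (cexp_G_meas P (sF _)).
(* The chosen conditional expectations of [a k] agree with the scaled [g k] only almost everywhere,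
   so this formula is verified on integrals and transferred by uniqueness of versions. *)
have vE : {ae P, forall x, forall i, cond_var P F (fun n => cexp P (F n) (a k)) i x =
    ((mu k) ^- 2)%:E * (v i x * (\1_(dyad k i) x)%:E)}%E.
  apply: ae_foralln => i; apply: (cexp_nn_ae_unique (sF i) (@FM i)).
  have c0 : 0 <= mu k ^- 2 by rewrite invr_ge0 sqr_ge0.
  split; last split=> [x|A FA].
  - apply/(G_meas_eP (sF i)); apply: emeasurable_funM => //.
    apply: emeasurable_funM.
      by apply/(G_meas_eP (sF i)); exact: (cond_var_adapted P hF fF).
    apply/measurable_EFinP; apply: measurable_indic.
    exact/(sub_measurableP (sF i)).
  - by rewrite mule_ge0 ?lee_fin.
  have mA := FM FA.
  rewrite ge0_integralZl_EFin//; last exact: measurable_funTS.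
  rewrite -xi2E// -ge0_integralZl_EFin//; last 2 first.
  - by move=> x _; rewrite lee_fin sqr_ge0.
  - exact: measurable_funTS.
  apply: ae_eq_integral => //.
  - by apply: emeasurable_funM => //; exact: measurable_funTS.
  - by apply/measurable_EFinP/measurable_funTS; exact: mX.
  - by apply: filterS (XE i) => x; rewrite /X => -> _; rewrite EFinM.
apply: filterS vE => x vE _; rewrite sqfunE.
have NkE : (N k)^-1%E = sqrte (((mu k) ^- 2 * theta (k + 1))%:E).
  rewrite -(fineK (N_fin k)) inver (negbTE nN0) /=; congr EFin.
  rewrite /mu /theta -exprVn -exprMn sqrtr_sqr ger0_norm; last first.
    by rewrite mulr_ge0 ?invr_ge0 ?mulr_ge0// ltW.
  by rewrite invfM mulrAC mulVf ?mul1r// gt_eqF.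
rewrite -/(N k) NkE lee_sqrt; last by rewrite lee_fin mulr_ge0// invr_ge0 sqr_ge0.
under eq_eseriesr do rewrite vE.
have c0 : 0 <= mu k ^- 2 by rewrite invr_ge0 sqr_ge0.
rewrite nneseriesZl// EFinM lee_wpmul2l//.
apply: lime_le; first exact: is_cvg_nneseries.
by apply: nearW => n; rewrite big_mkord; exact: v_dyad_sum.
Qed.

(** If the norm of the support vanishes then [mu k = 0] and the left side is zero; the right side is
    zero off the null set [Bset (nu k)], so the piece lost by the normalisation is negligible. *)
Let mu_cexp k n :
  {ae P, forall x, mu k * cexp P (F n) (a k) x = g k n x}.
Proof.
have [n0|nN0] := eqVneq (fine (N k)) 0.
  have Nk0 : N k = 0%E by rewrite -(fineK (N_fin k)) n0.
  have mB := measurable_Bset hF (@nu_stop k).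
  exists (Bset (nu k)); split => //; first exact: (ind_norm_eq0 hphi).
  move=> x /=; apply: contra_notP => xB.
  rewrite /mu n0 mulr0 mul0r g_eq0//.
  by rewrite /nu_ge; move: xB; rewrite /Bset/=; case: (nu k x) => // m [].
have muN0 : mu k != 0 by rewrite mulf_neq0// gt_eqF.
by apply: filterS (cexp_a k n) => x ->; rewrite mulrA mulfV// mul1r.
Qed.

(** As a function of the level [k], its consecutive differences are the indicators of [dyad], so
    symmetric sums over levels telescope. *)
Let below (i : nat) (x : T) (k : int) : R :=
  if (S i.+1 x <= (theta k)%:E)%E then 1 else 0.

Let indic_dyad k i x : \1_(dyad k i) x = below i x (k + 1) - below i x k.
Proof.
rewrite indicE /below; have [h1|h1] := leP (S i.+1 x) (theta k)%:E.
  rewrite (le_trans h1) ?lee_fin ?thetaS// subrr memNset//.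
  by move=> [/= + _]; rewrite ltNge h1.
case: ifPn => h2; first by rewrite mem_set ?subr0.
by rewrite memNset ?subr0// => -[_ /= h3]; rewrite h3 in h2.
Qed.

Let sum_xi_symmetric i x M :
  \sum_(z < M.*2.+1) xi (z%:Z - M%:Z) i x =
  diff i x * (below i x (M%:Z + 1) - below i x (- M%:Z)).
Proof.
rewrite /xi -mulr_sumr; congr (_ * _).
have -> : below i x (M%:Z + 1) - below i x (- M%:Z) =
    below i x (M.*2.+1%:Z - M%:Z) - below i x (0%:Z - M%:Z).
  by congr (below _ _ _ - below _ _ _); [rewrite -addnn; lia|lia].
rewrite -(@telescope_sumr R 0%N M.*2.+1 (fun z : nat => below i x (z%:Z - M%:Z)))//.
rewrite big_mkord; apply: eq_bigr => z _; rewrite indic_dyad.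
by congr (below _ _ _ - _); lia.
Qed.

Let theta_cvg (s : R) : 0 < s -> \forall M \near \oo,
  s <= theta (M%:Z + 1) /\ theta (- M%:Z) < s.
Proof.
move=> s0.
have le2 (m : nat) : (2 : R) ^+ m <= theta m.
  rewrite /theta /t -exprnP expr2 ler_peMl ?exprn_ge0//.
  by rewrite exprn_ege1// ler1n.
near=> M; split.
  apply: le_trans (thetaS _); apply: le_trans (le2 _).
  by apply/ltW/upper_nthrootP; near: M; exact: nbhs_infty_ge.
have : s^-1 < theta M.
  apply: lt_le_trans (le2 _); apply: upper_nthrootP.
  by near: M; exact: nbhs_infty_ge.
rewrite /theta /t -exprnN exprVn -exprnP => h1.
by rewrite invf_plt ?posrE// !exprn_gt0.
Unshelve. all: by end_near. Qed.

(** Off a null set, each increment either has [S i.+1 = 0] and vanishes, or has [S i.+1] positive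
    and finite, hence eventually in the window from [theta (- M)] to [theta (M + 1)]. Each of the
    [n] telescoped terms is thus eventually constant. *)
Let decomp_cvg n : {ae P, forall x,
  \sum_(z < M.*2.+1) mu (z%:Z - M%:Z) * cexp P (F n) (a (z%:Z - M%:Z)) x
    @[M --> \oo] --> f n x}.
Proof.
(* [zigzag] lists the integers as a sequence, so one null set serves all levels. *)
have H1 := ae_foralln (fun j => mu_cexp (zigzag j) n).
have H2 : {ae P, forall x, (sqfun P F f x < +oo)%E}.
  apply: (LMO_norm_lty_ae hphi) => //.
  rewrite (_ : sqfun P F f = fun x => poweR (\sum_(i <oo) v i x)%E 2^-1); last first.
    by apply/funext => x; rewrite poweR12_sqrt//; exact: nneseries_ge0.
  apply: (measurableT_comp (measurable_poweR _)).
  by apply: ge0_emeasurable_sum => // i _; exact: (measurable_cond_var P hF fF).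
have H3 : {ae P, forall x, forall i, v i x = 0%E -> diff i x = 0}.
  apply: ae_foralln => i.
  have FA : F i [set x | v i x = 0%E].
    apply/(sub_measurableP (sF i)); rewrite -[X in measurable X]setTI.
    have := cond_var_adapted P hF fF i => /(G_meas_eP (sF i)) mv.
    exact: (mv measurableT [set 0%E] (emeasurable_set1 _)).
  by have [_ H] := @cond_var_eq0 _ _ _ P F hF f fF i _ FA; apply: H; exact: aeW.
apply: filterS3 H1 H2 H3 => x h1 h2 h3.
have hk k : mu k * cexp P (F n) (a k) x = g k n x.
  have [_ _ /(_ k I)[j _ <-]] := zigzag_bij; exact: h1.
have Sfin i : S i x \is a fin_num.
  rewrite ge0_fin_numE//; apply: le_lt_trans (S_lim i x) _.
  move: h2; rewrite sqfunE; set V := (\sum_(i <oo) _)%E.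
  have : (0 <= V)%E by exact: nneseries_ge0.
  by case: V => // r _ _; rewrite ltry.
have diff_cvg i :
    diff i x * (below i x (M%:Z + 1) - below i x (- M%:Z)) @[M --> \oo] --> diff i x.
  apply: cvg_near_cst.
  have [S0|SN0] := eqVneq (S i.+1 x) 0%E.
    rewrite h3; first by apply: nearW => M; rewrite mul0r.
    apply/eqP; rewrite eq_le v0 andbT -S0 /S big_ord_recr/= leeDr//.
    exact: S_ge0.
  have s0 : 0 < fine (S i.+1 x) by rewrite fine_gt0// lt0e SN0 S_ge0 ltey_eq Sfin.
  apply: filterS (theta_cvg s0) => M [s1 s2].
  rewrite /below -(fineK (Sfin i.+1)) !lee_fin s1 leNgt s2 /=.
  by rewrite subr0 mulr1.
have -> : f n x = \sum_(i < n) diff i x.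
  rewrite -(big_mkord xpredT (fun i => diff i x)) telescope_sumr//.
  by rewrite f0 subr0.
rewrite (_ : (fun M : nat => _) = (fun M : nat => \sum_(i < n)
    diff i x * (below i x (M%:Z + 1) - below i x (- M%:Z)))); last first.
  apply/funext => M; under eq_bigr do rewrite hk.
  rewrite /g exchange_big/=; apply: eq_bigr => i _; exact: sum_xi_symmetric.
clear hk h1; elim: n => [|n ih].
  rewrite big_ord0; under eq_fun do rewrite big_ord0; exact: cvg_cst.
by rewrite big_ord_recr/=; under eq_fun do rewrite big_ord_recr/=; exact: cvgD.
Qed.

Variable r : R.
Hypothesis r0 : 0 < r.

Let z k x := ((mu k)%:E * (\1_(Bset (nu k)) x)%:E * (N k)^-1)%E.

Let z_ge0 k x : (0 <= z k x)%E.
Proof. by rewrite /z !mule_ge0 ?lee_fin// inve_ge0 LMO_norm_ge0. Qed.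

(** The norm in [mu k] cancels its inverse and leaves [t (k + 1)]; for a zero norm the convention
    [0 * +oo = 0] gives [z k x = 0]. *)
Let z_le k x : (z k x <= (t (k + 1) * \1_(Bset (nu k)) x)%:E)%E.
Proof.
have [n0|nN0] := eqVneq (fine (N k)) 0.
  by rewrite /z /mu n0 mulr0 !mul0e lee_fin mulr_ge0// ltW.
rewrite /z -(fineK (N_fin k)) inver (negbTE nN0) -!EFinM lee_fin.
by rewrite /mu le_eqVlt; apply/orP; left; apply/eqP; field.
Qed.

Lemma at_quantity_integrand_le x :
  (poweR (\esum_(k in [set: int]) poweR (z k x) r) r^-1 <=
   (dyadic_const r `^ r^-1)%:E * sqfun P F f x)%E.
Proof.
have K0 := dyadic_const_gt0 r0.
have Kr0 : 0 < dyadic_const r `^ r^-1 by exact: powR_gt0.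
have [->|sN] := eqVneq (sqfun P F f x) +oo%E.
  by rewrite gt0_muley ?lte_fin// leey.
have sfin : sqfun P F f x \is a fin_num by rewrite ge0_fin_numE// ltey.
set s := fine (sqfun P F f x).
have s0 : 0 <= s by exact: fine_ge0.
suff H : (\esum_(k in [set: int]) poweR (z k x) r <= (dyadic_const r * s `^ r)%:E)%E.
  rewrite -(fineK sfin) -EFinM -/s.
  have -> : dyadic_const r `^ r^-1 * s = (dyadic_const r * s `^ r) `^ r^-1.
    by rewrite powRM ?powR_ge0 ?(ltW K0)// -powRrM mulfV ?gt_eqF// powRr1.
  rewrite -poweR_EFin gt0_ler_poweR ?invr_ge0 ?(ltW r0)//.
  - rewrite in_itv/= leey andbT; apply: esum_ge0 => k _; exact: poweR_ge0.
  - by rewrite in_itv/= leey andbT lee_fin mulr_ge0 ?powR_ge0 ?(ltW K0).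
rewrite esum_zigzag; last by move=> k; exact: poweR_ge0.
apply: lime_le; first by apply: is_cvg_nneseries => j _ _; exact: poweR_ge0.
apply: nearW => M.
(* Padding to [2 M + 1] terms turns the partial sum into a symmetric one over consecutive levels, to
   which [dyadic_sum_le] applies. *)
apply: (@le_trans _ _ (\sum_(0 <= j < M.*2.+1) poweR (z (zigzag j) x) r)%E).
  apply: lee_sum_nneg_natr => [j _ _|]; first exact: poweR_ge0.
  by rewrite -addnn leqW// leq_addr.
rewrite big_mkord -(sum_symmetric_zigzag (fun k => poweR (z k x) r)).
have := dyadic_sum_le r0 M M.*2.+1 s0; rewrite -lee_fin; apply: le_trans.
rewrite -sumEFin; apply: lee_sum => i _; set k := _ - _.
apply: (@le_trans _ _ (poweR (t (k + 1) * \1_(Bset (nu k)) x)%:E r)).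
  rewrite gt0_ler_poweR ?(ltW r0)//.
  - by rewrite in_itv/= leey andbT.
  - by rewrite in_itv/= leey andbT ?lee_fin mulr_ge0// ltW.
rewrite poweR_EFin lee_fin indicE; have [xB|xB] := boolP (x \in Bset (nu k)).
  move: xB; rewrite inE => /BsetE; rewrite -(fineK sfin) lte_fin -/s => ks.
  by rewrite ks mulr1.
rewrite mulr0 powR0 ?gt_eqF//.
by case: ifP => // _; exact: powR_ge0.
Qed.

Lemma Hat_norm_le_Hs_norm_fin :
  (Hat_norm P F phi r f <= (dyadic_const r `^ r^-1)%:E * Hs_norm P F phi f)%E.
Proof.
apply: (@le_trans _ _ (at_quantity P phi r mu nu)).
  by apply: ereal_inf_lbound; exists mu, a, nu; split.
have Kr0 : 0 < dyadic_const r `^ r^-1.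
  by apply: powR_gt0; exact: dyadic_const_gt0.
apply: le_trans (LMO_normZ P phi Kr0 sqf_ge0).
apply: le_LMO_norm; first exact: hphi.
- by move=> x; exact: poweR_ge0.
- by move=> x; rewrite mule_ge0// lee_fin ltW.
- by apply: aeW => x; exact: at_quantity_integrand_le.
Qed.

End AtomicDecomposition.

(* H^s_phi = H^{phi,oo,s}_{at,r} with equivalent quasi-norms: for every
   martingale f, each quasi-norm is bounded by C times the other (in \bar R,
   so in particular one is finite iff the other is). *)
Theorem theorem4p1 (d : measure_display) (T : measurableType d) (R : realType)
    (P : probability T R) (F : nat -> set (set T))
    (hF : is_filtration F) (phi : T -> R -> R) (hphi : MO_function phi)
    (r : R) (hr0 : 0 < r) (hr1 : r <= 1) :
  exists C : R, 0 < C /\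
    forall f : nat -> T -> R, martingale P F f ->
      (Hat_norm P F phi r f <= C%:E * Hs_norm P F phi f)%E /\
      (Hs_norm P F phi f <= C%:E * Hat_norm P F phi r f)%E.
Proof.
pose K : R := dyadic_const r `^ r^-1.
have K0 : 0 < K by apply: powR_gt0; exact: dyadic_const_gt0.
(* [K] serves the decomposition and 1 the converse estimate; the sum dominates both. *)
exists (1 + K); split=> [|f hf]; first by rewrite addr_gt0.
have Hs0 : (0 <= Hs_norm P F phi f)%E by exact: LMO_norm_ge0.
have fF n : G_meas (F n) (f n) by case: hf => _ [h _]; exact: h.
have HsHat := Hs_norm_le_Hat_norm P hF hphi hr0 hr1 fF.
split.
  (* The atoms are constructed for finite [Hs_norm]; otherwise the right-hand side is [+oo]. *)
  have [->|Hsfin] := eqVneq (Hs_norm P F phi f) +oo%E.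
    by rewrite gt0_muley ?lte_fin ?addr_gt0// leey.
  apply: (@le_trans _ _ (K%:E * Hs_norm P F phi f)%E).
    by apply: Hat_norm_le_Hs_norm_fin => //; rewrite ltey.
  by rewrite lee_wpmul2r// lee_fin lerDr.
apply: (le_trans HsHat); rewrite -[leLHS]mul1e lee_wpmul2r//.
  exact: le_trans HsHat.
by rewrite lee_fin lerDl ltW.
Qed.
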